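(* Let $\mathcal A$ be a subobject finite, exact Mal'tsev (regular) category, $\mathbb K$ a field and $\delta$ a $\mathbb K$-valued degree function on $\mathcal A$. Let $x,y,z$ be objects of $\mathcal A$, let $u\in R_{\mathrm q}(x,y)$ and $v\in R_{\mathrm q}(y,z)$. Let $\overline y:=\operatorname{im}(y\to u\times v)$ and let $w:=u\amalg_yv$ be the push-out of $u\twoheadleftarrow y\twoheadrightarrow v$ (so that $\overline y=u\times_wv$). Then, in $\operatorname{Hom}_{\mathcal T(\mathcal A,\delta)}([x]^*,[z]^* )$, $$\{v\}'\,\{u\}'=\omega_{y\twoheadrightarrow\overline y}\sum_{\substack{t\in R_{\mathrm q}(u,v)\\ t\le w}}\mu_{\mathrm q}(t,w)\ \{t\}',$$ where on the right hand side $t$ is regarded as an element of $R_{\mathrm q}(x,z)$ via the composites $x\twoheadrightarrow u\twoheadrightarrow t$ and $z\twoheadrightarrow v\twoheadrightarrow t$, $w$ is regarded as an element of $R_{\mathrm q}(u,v)$, and $\mu_{\mathrm q}$ is the Möbius function of the poset $R_{\mathrm q}(u,v)$.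
   Context: **Subobjects, images.** Subobjects of an object $x$ are equivalence classes of monomorphisms into $x$, ordered by factorization (written $\subseteq$); $\mathrm s(x)$ is the poset of subobjects of $x$. The image of $f:x\to y$ is the smallest subobject of $y$ through which $f$ factors; for $u\subseteq x$, $f(u)$ is the image of $u\to x\to y$. A morphism is surjective (written $\twoheadrightarrow$) if its image is its whole target. **Regular category.** $\mathcal A$ is regular if: (R0) subobjects of each object form a set; (R1) every morphism has an image; (R2) there is a terminal object; (R3) whenever $x\to z\leftarrow y$ can be completed to a commutative square by some $u\to x$, $u\to y$, the pullback $x\times_zy$ exists; (R4) the pullback of a surjective morphism along an arbitrary morphism exists and is surjective. Finite limits that do not exist in $\mathcal A$ are taken to be a formally adjoined initial object $\varnothing$ (not an object of $\mathcal A$ and not counted as a subobject). $\mathcal A$ is subobject finite if every $\mathrm s(x)$ is finite. A regular category is Mal'tsev if for every object $x$ any subobject $r\subseteq x\times x$ containing the diagonal is an equivalence relation. It is exact if for every equivalence relation $r\subseteq x\times x$ there is a surjective morphism $x\twoheadrightarrow y$ with $r=x\times_yx$. **Degree function.** A $\mathbb K$-valued degree function $\delta$ assigns to each surjective $e:x\twoheadrightarrow y$ an element $\delta(e)\in\mathbb K$ with $\delta(\mathrm{id}_x)=1$; $\delta(\bar e)=\delta(e)$ if $\bar e$ is a pullback of $e$; $\delta(e\bar e)=\delta(e)\delta(\bar e)$ for composable surjective $e,\bar e$. **The category $\mathcal T^0(\mathcal A,\delta)$.** Objects: symbols $[x]$ for $x$ an object of $\mathcal A$. A relation between $x$ and $y$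 is a subobject $r$ of $x\times y$. $\operatorname{Hom}([x],[y])$ is the $\mathbb K$-vector space with basis $\langle r\rangle$, $r$ running through the relations between $x$ and $y$; $\langle\varnothing\rangle:=0$. For $r\subseteq x\times y$, $s\subseteq y\times z$ let $s\circ r$ be the image of $r\times_ys$ in $x\times z$; composition is $\langle s\rangle\langle r\rangle:=\delta(r\times_ys\twoheadrightarrow s\circ r)\,\langle s\circ r\rangle$ if $r\times_ys$ exists, and $0$ otherwise. $\mathcal T(\mathcal A,\delta)$ is the pseudo-abelian closure of $\mathcal T^0(\mathcal A,\delta)$: objects are $pX$ with $X$ a formal finite direct sum of objects $[x_\nu]$ and $p$ an idempotent endomorphism of $X$; $\operatorname{Hom}(pX,qY)=q\operatorname{Hom}(X,Y)p$. **Notation.** For $f:x\to y$ with graph $\Gamma_f\subseteq x\times y$, $[f]:=\langle\Gamma_f\rangle:[x]\to[y]$ and $[f]^\vee:=\langle\Gamma_f^\vee\rangle:[y]\to[x]$, where $\Gamma_f^\vee$ is $\Gamma_f$ with factors switched. For a subobject $i:u\hookrightarrow x$, $p_u:=[i][i]^\vee\in\operatorname{End}([x])$. For $v\in\mathrm s(x)$, $p_v^*:=\sum_{u\subseteq v}\mu(u,v)p_u\in\operatorname{End}([x])$, with $\mu$ the Möbius function of $\mathrm s(x)$. Put $[x]^*:=p_x^*[x]$. For surjective $e:x\twoheadrightarrow y$, $\omega_e:=\sum_{u\in\mathrm s(x),\,e(u)=y}\mu(u,x)\,\delta(u\twoheadrightarrow y)\in\mathbb K$. **$R_{\mathrm q}(x,y)$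 and $\{u\}'$.** $R_{\mathrm q}(x,y)$ is the set of isomorphism classes of diagrams $x\overset{a}\twoheadrightarrow u\overset{b}\twoheadleftarrow y$ with $a,b$ surjective. It is partially ordered by $u\le v$ if the pair $x,y\twoheadrightarrow v$ factors through $x,y\twoheadrightarrow u$ (i.e. there is a morphism $u\to v$ compatible with the maps from $x$ and $y$). In an exact Mal'tsev category, by a known theorem of Carboni, Kelly and Pedicchio, $u\mapsto x\times_uy$ is a bijection from $R_{\mathrm q}(x,y)$ to the set of subobjects of $x\times y$ projecting surjectively onto $x$ and $y$, with inverse the push-out $r\mapsto x\amalg_ry$; in particular the push-outs used exist. For $u\in R_{\mathrm q}(x,y)$ as in the diagram, $\{u\}':=p_y^*[b]^\vee[a]p_x^*:[x]^*\to[y]^*$. *)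

(* Defs.v *)
From HB Require Import structures.
From mathcomp Require Import all_boot all_order all_algebra generic_quotient.
From mathcomp Require Import finmap.
From mathcomp Require Import boolp classical_sets cardinality fsbigop.

Set Implicit Arguments.
Unset Strict Implicit.
Unset Printing Implicit Defensive.

Import Order.TTheory GRing.Theory.
Local Open Scope ring_scope.
Local Open Scope quotient_scope.

Record category := Category {
  obj :> Type;
  hom : obj -> obj -> Type;
  idm : forall x, hom x x;
  ccomp : forall x y z, hom y z -> hom x y -> hom x z;
  ccomp1f : forall x y (f : hom x y), ccomp (idm y) f = f;
  ccompf1 : forall x y (f : hom x y), ccomp f (idm x) = f;
  ccompA : forall x y z t (h : hom z t) (g : hom y z) (f : hom x y),
    ccomp h (ccomp g f) = ccomp (ccomp h g) f }.

Arguments hom {c} x y.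
Arguments idm {c} x.
Arguments ccomp {c x y z} g f.
Notation "g ∘ f" := (ccomp g f) (at level 40, left associativity).

Section Basics.
Variable C : category.
Implicit Types x y z t u : C.

Definition monic x y (f : hom x y) :=
  forall t (g h : hom t x), f ∘ g = f ∘ h -> g = h.

Definition epic x y (f : hom x y) :=
  forall t (g h : hom y t), g ∘ f = h ∘ f -> g = h.

Definition terminal o := forall x, exists! f : hom x o, True.

Record span x y := Span { apex : C; lft : hom apex x; rgt : hom apex y }.

Definition is_product x y (s : span x y) :=
  forall t (a : hom t x) (b : hom t y),
    exists! h : hom t (apex s), lft s ∘ h = a /\ rgt s ∘ h = b.

Definition is_pullback x y z (f : hom x z) (g : hom y z) (s : span x y) :=
  f ∘ lft s = g ∘ rgt s /\
  forall t (a : hom t x) (b : hom t y), f ∘ a = g ∘ b ->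
    exists! h : hom t (apex s), lft s ∘ h = a /\ rgt s ∘ h = b.

Record mono x := Mono { mdom : C; mmap :> hom mdom x; mmapP : monic mmap }.

HB.instance Definition _ x := gen_eqMixin (mono x).
HB.instance Definition _ x := gen_choiceMixin (mono x).

Lemma monic_id x : monic (idm x).
Proof. by move=> t g h; rewrite !ccomp1f. Qed.

Lemma monic_comp x y z (g : hom y z) (f : hom x y) :
  monic g -> monic f -> monic (g ∘ f).
Proof. by move=> Mg Mf t a b; rewrite -!ccompA => /Mg/Mf. Qed.

Definition mono_id x := Mono (@monic_id x).

Definition factors x y z (f : hom x z) (g : hom y z) := exists h, g ∘ h = f.

Definition mono_equiv x : rel (mono x) :=
  fun m n => `[< factors m n /\ factors n m >].

Lemma factors_refl x y (f : hom x y) : factors f f.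
Proof. by exists (idm _); rewrite ccompf1. Qed.

Lemma factors_trans x1 x2 x3 y (f : hom x1 y) (g : hom x2 y) (h : hom x3 y) :
  factors f g -> factors g h -> factors f h.
Proof. by move=> [a <-] [b <-]; exists (b ∘ a); rewrite ccompA. Qed.

Lemma mono_equiv_refl x : reflexive (@mono_equiv x).
Proof. by move=> m; apply/asboolP; split; exact: factors_refl. Qed.

Lemma mono_equiv_sym x : symmetric (@mono_equiv x).
Proof. by move=> m n; apply/asboolP/asboolP => -[]. Qed.

Lemma mono_equiv_trans x : transitive (@mono_equiv x).
Proof.
move=> n m p /asboolP[h1 h2] /asboolP[h3 h4]; apply/asboolP.
by split; [exact: factors_trans h3 | exact: factors_trans h2].
Qed.

Canonical mono_equiv_rel x := EquivRel (@mono_equiv x)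
  (@mono_equiv_refl x) (@mono_equiv_sym x) (@mono_equiv_trans x).

Definition sub x := {eq_quot (mono_equiv_rel x)}.
HB.instance Definition _ x := Choice.on (sub x).

Definition subm x (u : sub x) : mono x := repr u.
Definition sub_of x (m : mono x) : sub x := \pi_(sub x) m.

Lemma sub_ofP x (m n : mono x) :
  sub_of m = sub_of n <-> factors m n /\ factors n m.
Proof.
split=> [|h]; last by apply/eqmodP; apply/asboolP.
by move=> /eqmodP /asboolP.
Qed.

Lemma submK x (u : sub x) : sub_of (subm u) = u.
Proof. exact: reprK. Qed.

Lemma sub_ofK x (m : mono x) :
  factors m (subm (sub_of m)) /\ factors (subm (sub_of m)) m.
Proof. by apply/sub_ofP; rewrite submK. Qed.

Definition sub_le x (u v : sub x) := `[< factors (subm u) (subm v) >].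
Definition sub_lt x (u v : sub x) := (v != u) && sub_le u v.

Lemma sub_le_refl x : reflexive (@sub_le x).
Proof. by move=> u; apply/asboolP; exact: factors_refl. Qed.

Lemma sub_le_anti x : antisymmetric (@sub_le x).
Proof.
move=> u v /andP[/asboolP h1 /asboolP h2].
by rewrite -(submK u) -(submK v); apply/sub_ofP.
Qed.

Lemma sub_le_trans x : transitive (@sub_le x).
Proof.
by move=> v u w /asboolP h1 /asboolP h2; apply/asboolP; exact: factors_trans h2.
Qed.

Fact sub_display : Order.disp_t. Proof. exact: Order.Disp tt tt. Qed.
HB.instance Definition _ x := Order.isPOrder.Build sub_display (sub x)
  (fun _ _ => erefl) (@sub_le_refl x) (@sub_le_anti x) (@sub_le_trans x).

Definition sub_top x : sub x := sub_of (mono_id x).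

Definition is_image x y (f : hom x y) (m : mono y) :=
  factors f m /\ forall n : mono y, factors f n -> factors m n.

Definition surjective x y (f : hom x y) := is_image f (mono_id y).

End Basics.

(* That the subobjects of an object form a set is automatic: [sub x] is a type. *)
Record regular_axioms (C : category) : Prop := RegularAxioms {
  regular_image : forall (x y : C) (f : hom x y), exists m, is_image f m;
  regular_terminal : exists o : C, terminal o;
  regular_pullback : forall (x y z : C) (f : hom x z) (g : hom y z),
    (exists (u : C) (a : hom u x) (b : hom u y), f ∘ a = g ∘ b) ->
    exists s, is_pullback f g s;
  regular_surjective : forall (x y z : C) (e : hom x z) (g : hom y z),
    surjective e ->
    (exists s, is_pullback e g s) /\
    (forall s, is_pullback e g s -> surjective (rgt s)) }.

Record sf_regular_category := SFRegular {
  sf_category :> category;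
  sf_regular : regular_axioms sf_category;
  sf_finite : forall x : sf_category, finite_set [set: sub x] }.

Section SubFinType.
Variables (A : sf_regular_category) (x : A).

Lemma sub_enum_ex : exists s : seq (sub x), forall u, u \in s.
Proof.
have /finite_seqP[s sE] := sf_finite x.
by exists s => u; have : [set: sub x]%classic u by []; rewrite sE.
Qed.

Definition sub_enum : seq (sub x) := undup (sval (cid sub_enum_ex)).

Lemma mem_sub_enum u : u \in sub_enum.
Proof. by rewrite mem_undup; case: cid. Qed.

Lemma sub_pickleK : pcancel (index^~ sub_enum) (onth sub_enum).
Proof.
move=> u; apply/eqP; rewrite onthE (nth_map u) ?index_mem ?mem_sub_enum //.
by rewrite nth_index ?mem_sub_enum.
Qed.

HB.instance Definition _ := 
  Choice_isCountable.Build (sub x) sub_pickleK.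

Lemma sub_enumP : Finite.axiom sub_enum.
Proof.
by move=> u; rewrite count_uniq_mem ?undup_uniq // mem_sub_enum.
Qed.

HB.instance Definition _ := isFinite.Build (sub x) sub_enumP.
End SubFinType.

Section Regular.
Variable A : sf_regular_category.
Implicit Types x y z t : A.

(* The left alternative is the object [x * y]; the right one is the formally
   adjoined empty object, taken when no product exists.  Likewise below. *)
Definition product x y :
    {s : span x y | is_product s} + {~ exists s : span x y, is_product s} :=
  match pselect (exists s : span x y, is_product s) with
  | left h => inleft (cid h)
  | right h => inright h
  end.

Definition pullback x y z (f : hom x z) (g : hom y z) :
    {s : span x y | is_pullback f g s} +
    {~ exists s : span x y, is_pullback f g s} :=
  match pselect (exists s : span x y, is_pullback f g s) with
  | left h => inleft (cid h)
  | right h => inright h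
  end.

Lemma pairing_ex x y (P : {s : span x y | is_product s}) t
    (a : hom t x) (b : hom t y) :
  exists h : hom t (apex (sval P)),
    lft (sval P) ∘ h = a /\ rgt (sval P) ∘ h = b.
Proof. by case: P => s sP /=; have [h [h1 _]] := sP t a b; exists h. Qed.

Definition pairing x y (P : {s : span x y | is_product s}) t
    (a : hom t x) (b : hom t y) : hom t (apex (sval P)) :=
  sval (cid (pairing_ex P a b)).

Lemma pairingP x y (P : {s : span x y | is_product s}) t
    (a : hom t x) (b : hom t y) :
  lft (sval P) ∘ pairing P a b = a /\ rgt (sval P) ∘ pairing P a b = b.
Proof. by rewrite /pairing; case: cid. Qed.

Definition im x y (f : hom x y) : sub y :=
  sub_of (sval (cid (regular_image (sf_regular A) f))).

Definition relation x y : finType :=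
  match product x y with
  | inleft P => sub (apex (sval P))
  | inright _ => void
  end.

Definition relation_span x y : relation x y -> span x y :=
  match product x y as o return
    (match o with inleft P => sub (apex (sval P)) | inright _ => void end :
       finType) -> span x y with
  | inleft P => fun r =>
      Span (lft (sval P) ∘ subm r) (rgt (sval P) ∘ subm r)
  | inright _ => fun r => match r with end
  end.

Lemma product_exists x y (s : span x y) : exists p : span x y, is_product p.
Proof.
have [o oT] := regular_terminal (sf_regular A).
have [f [_ fU]] := oT x; have [g [_ gU]] := oT y.
have := @regular_pullback _ (sf_regular A) x y o f g.
case.
  exists (apex s), (lft s), (rgt s).
  by have [k [_ kU]] := oT (apex s); rewrite -(kU (f ∘ _)) // -(kU (g ∘ _)).
move=> p [_ pU]; exists p => t a b; apply: pU.
by have [k [_ kU]] := oT t; rewrite -(kU (f ∘ _)) // -(kU (g ∘ _)).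
Qed.

(* The image in [x * y] of the morphism [(lft s, rgt s)]. *)
Definition span_im x y (s : span x y) : relation x y :=
  match product x y as o return
    (match o with inleft P => sub (apex (sval P)) | inright _ => void end :
       finType) with
  | inleft P => im (pairing P (lft s) (rgt s))
  | inright h => False_rect _ (h (product_exists s))
  end.

Definition span_hom x y (s s' : span x y) (h : hom (apex s) (apex s')) :=
  lft s' ∘ h = lft s /\ rgt s' ∘ h = rgt s.

Lemma prod_ext x y (P : span x y) (Pp : is_product P) t (a b : hom t (apex P)) :
  lft P ∘ a = lft P ∘ b -> rgt P ∘ a = rgt P ∘ b -> a = b.
Proof.
move=> h1 h2; have [k [_ kU]] := Pp t (lft P ∘ a) (rgt P ∘ a).
by rewrite -(kU a) // -(kU b).
Qed.

Lemma relation_monic x y (r : relation x y) t (a b : hom t (apex (relation_span r))) :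
  lft (relation_span r) ∘ a = lft (relation_span r) ∘ b ->
  rgt (relation_span r) ∘ a = rgt (relation_span r) ∘ b -> a = b.
Proof.
move: r a b; rewrite /relation /relation_span.
case: product => [[P Pp]|?] /= r; last by case: r.
move=> a b; rewrite -!ccompA => h1 h2; apply: (@mmapP _ _ (subm r)).
exact: prod_ext h1 h2.
Qed.

Lemma im_mono_surj x y z (f : hom x y) (m : mono y) (e : hom x (mdom m)) :
  is_image f m -> m ∘ e = f -> surjective e.
Proof.
move=> [_ fU] mE; split; first by exists e; rewrite /= ccomp1f.
move=> n [h hE]; have [|k kE] := fU (Mono (monic_comp (@mmapP _ _ m) (@mmapP _ _ n))).
  by exists h; rewrite /= -ccompA hE.
exists k; apply: (@mmapP _ _ m); rewrite /= ccompA -[X in _ = X]ccompf1 in kE *.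
by rewrite ccompf1 kE ccompf1.
Qed.

Lemma is_image_trans x y (f : hom x y) (m m' : mono y) :
  is_image f m -> factors m m' -> factors m' m -> is_image f m'.
Proof.
move=> [f1 f2] h1 h2; split; first exact: factors_trans h1.
by move=> n /f2; exact: factors_trans.
Qed.

Lemma imP x y (f : hom x y) : is_image f (subm (im f)).
Proof.
rewrite /im; case: cid => m /= fm; have [h1 h2] := sub_ofK m.
exact: is_image_trans fm h1 h2.
Qed.

Lemma im_unique x y (f : hom x y) (u : sub y) : is_image f (subm u) -> im f = u.
Proof.
move=> [h1 h2]; have [h3 h4] := imP f.
by rewrite -(submK u) -(submK (im f)); apply/sub_ofP; split; [exact: h4 | exact: h2].
Qed.

Lemma surjective_sec x y (e : hom x y) (n : mono y) :
  surjective e -> factors e n -> exists k, n ∘ k = idm y.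
Proof. by move=> [_ h] /h. Qed.

Lemma surjective_id x : surjective (idm x).
Proof. by split=> //; exact: factors_refl. Qed.

Lemma surjective_cancel x y z (g : hom y z) (f : hom x y) :
  surjective (g ∘ f) -> surjective g.
Proof.
move=> gf; split=> [|n [h hE]]; first by exists g; rewrite /= ccomp1f.
by apply: (proj2 gf); exists (h ∘ f); rewrite ccompA hE.
Qed.

Lemma pullback_ext x y z (f : hom x z) (g : hom y z) (P : span x y) :
  is_pullback f g P -> forall t (a b : hom t (apex P)),
  lft P ∘ a = lft P ∘ b -> rgt P ∘ a = rgt P ∘ b -> a = b.
Proof.
move=> [fg PU] t a b h1 h2.
have [|k [_ kU]] := PU t (lft P ∘ a) (rgt P ∘ a); first by rewrite !ccompA fg.
by rewrite -(kU a) // -(kU b).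
Qed.

Lemma pullback_monic x y z (f : hom x z) (g : hom y z) (P : span x y) :
  is_pullback f g P -> monic g -> monic (lft P).
Proof.
move=> Pb Mg t a b h; apply: (pullback_ext Pb) => //.
by apply: Mg; rewrite !ccompA -(proj1 Pb) -!ccompA h.
Qed.

Lemma surjective_comp x y z (g : hom y z) (f : hom x y) :
  surjective g -> surjective f -> surjective (g ∘ f).
Proof.
move=> Sg Sf; split; first by exists (g ∘ f); rewrite /= ccomp1f.
move=> n [h hE].
have [|P Pb] := @regular_pullback _ (sf_regular A) _ _ _ g n.
  by exists x, f, h.
have [k [[k1 k2] _]] := proj2 Pb _ f h (esym hE).
have [|k' k'E] := @surjective_sec _ _ _ (Mono (pullback_monic Pb (@mmapP _ _ n))) Sf.
  by exists k.
apply: (proj2 Sg); exists (rgt P ∘ k').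
by rewrite ccompA -(proj1 Pb) -ccompA /= in k'E *; rewrite k'E ccompf1.
Qed.

Definition is_iso x y (f : hom x y) :=
  exists g, g ∘ f = idm x /\ f ∘ g = idm y.

Lemma iso_surjective x y (f : hom x y) : is_iso f -> surjective f.
Proof.
by move=> [g [_ fg]]; apply: (@surjective_cancel _ _ _ f g); rewrite fg; exact: surjective_id.
Qed.

Lemma monic_surjective x y (f : hom x y) : monic f -> surjective f -> is_iso f.
Proof.
move=> Mf Sf; have [|k /= kE] := @surjective_sec _ _ _ (Mono Mf) Sf.
  exact: factors_refl.
by exists k; split=> //; apply: (Mf _); rewrite ccompA kE ccomp1f ccompf1.
Qed.

Lemma surjective_epic x y (e : hom x y) : surjective e -> epic e.
Proof.
move=> Se z f g fg.
have [P Pp] := product_exists (Span (idm z) (idm z)).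
have [d [[d1 d2] _]] := Pp z (idm z) (idm z).
have [h [[h1 h2] _]] := Pp y f g.
have [|Q Qb] := @regular_pullback _ (sf_regular A) _ _ _ h d.
  exists x, e, (f ∘ e); apply: (prod_ext Pp).
    by rewrite !ccompA h1 d1 ccomp1f.
  by rewrite !ccompA h2 d2 ccomp1f fg.
have Mq : monic (lft Q).
  apply: (pullback_monic Qb) => t a b ab.
  by rewrite -[a]ccomp1f -[b]ccomp1f -d1 -!ccompA ab.
have [k [[k1 _] _]] : exists! k, lft Q ∘ k = e /\ rgt Q ∘ k = f ∘ e.
  apply: (proj2 Qb); apply: (prod_ext Pp).
    by rewrite !ccompA h1 d1 ccomp1f.
  by rewrite !ccompA h2 d2 ccomp1f fg.
have [|k' /= k'E] := @surjective_sec _ _ _ (Mono Mq) Se; first by exists k.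
rewrite -[f]ccompf1 -[g]ccompf1 -k'E !ccompA -h1 -h2 -!(ccompA _ h).
by rewrite (proj1 Qb) !(ccompA _ d) d1 d2.
Qed.

Lemma span_im_ex x y (s : span x y) :
  exists e : hom (apex s) (apex (relation_span (span_im s))),
    surjective e /\ span_hom e.
Proof.
rewrite /relation_span /span_im /relation.
case: product => [P|n] /=; last by case: (n (product_exists s)).
have [p1 p2] := pairingP P (lft s) (rgt s).
set f := pairing _ _ _ in p1 p2 *.
have [[e eE] _] := imP f; exists e.
split; first exact: im_mono_surj (imP f) eE.
by split; rewrite /= -ccompA eE.
Qed.

Definition span_im_map x y (s : span x y) :
    hom (apex s) (apex (relation_span (span_im s))) :=
  sval (cid (span_im_ex s)).

Lemma span_im_map_surj x y (s : span x y) : surjective (span_im_map s).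
Proof. by rewrite /span_im_map; case: cid => ? []. Qed.

Lemma span_im_mapP x y (s : span x y) : span_hom (span_im_map s).
Proof. by rewrite /span_im_map; case: cid => ? []. Qed.

Lemma span_im_unique x y (s : span x y) (r : relation x y)
    (e : hom (apex s) (apex (relation_span r))) :
  surjective e -> span_hom e -> span_im s = r.
Proof.
move: r e; rewrite /relation_span /span_im /relation /span_hom.
case: product => [P|?] /= r; last by case: r.
move=> e Se [e1 e2]; apply: im_unique.
have [p1 p2] := pairingP P (lft s) (rgt s).
have eE : subm r ∘ e = pairing P (lft s) (rgt s).
  by apply: (prod_ext (svalP P)); rewrite ?p1 ?p2 ccompA.
split; first by exists e.
move=> n [h hE].
have [|Q Qb] := @regular_pullback _ (sf_regular A) _ _ _ (subm r) n.
  by exists (apex s), e, h; rewrite eE hE.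
have [|k [[k1 k2] _]] := proj2 Qb _ e h; first by rewrite eE hE.
have [|k' /= k'E] := @surjective_sec _ _ _ (Mono (pullback_monic Qb (@mmapP _ _ n))) Se.
  by exists k.
by exists (rgt Q ∘ k'); rewrite ccompA -(proj1 Qb) -ccompA k'E ccompf1.
Qed.

Lemma span_im_relation x y (r : relation x y) : span_im (relation_span r) = r.
Proof.
apply: (@span_im_unique _ _ _ _ (idm _)); first exact: surjective_id.
by rewrite /span_hom !ccompf1.
Qed.

Lemma span_hom_unique x y (s : span x y) (r : relation x y)
    (e e' : hom (apex s) (apex (relation_span r))) :
  span_hom e -> span_hom e' -> e = e'.
Proof.
move=> [h1 h2] [h3 h4].
by apply: relation_monic; rewrite ?h1 ?h2 ?h3 ?h4.
Qed.

(* [(a, b) : t -> x * y] factors through [r]. *)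
Definition related x y (r : relation x y) t (a : hom t x) (b : hom t y) :=
  exists h, lft (relation_span r) ∘ h = a /\ rgt (relation_span r) ∘ h = b.

Definition contains_diagonal x (r : relation x x) := related r (idm x) (idm x).

Definition equivalence_relation x (r : relation x x) :=
  forall t, [/\ forall a : hom t x, related r a a,
    forall a b : hom t x, related r a b -> related r b a &
    forall a b c : hom t x, related r a b -> related r b c -> related r a c].

Definition is_maltsev := forall x (r : relation x x),
  contains_diagonal r -> equivalence_relation r.

Definition is_exact := forall x (r : relation x x), equivalence_relation r ->
  exists (y : A) (e : hom x y),
    surjective e /\ is_pullback e e (relation_span r).

End Regular.

Section Tensor.
Variables (A : sf_regular_category) (K : fieldType).
Implicit Types x y z t : A.

(* The values of a degree function at non-surjective morphisms are junk. *)
Record degree_function := DegreeFunction {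
  degree : forall x y, hom x y -> K;
  degree_id : forall x, degree (idm x) = 1;
  degree_pullback : forall x y z (e : hom x z) (g : hom y z) (s : span x y),
    surjective e -> is_pullback e g s -> degree (rgt s) = degree e;
  degree_comp : forall x y z (g : hom y z) (f : hom x y),
    surjective g -> surjective f -> degree (g ∘ f) = degree g * degree f }.

Variable delta : degree_function.

Notation hom0 x y := {ffun relation x y -> K^o}.

Definition basis x y (r : relation x y) : hom0 x y :=
  [ffun s => (s == r)%:R].

(* [delta(t ->> u) <u>] where [u] is the image of the span [t] in [x * y]. *)
Definition span_vec x y (s : span x y) : hom0 x y :=
  degree delta (span_im_map s) *: basis (span_im s).

Definition span_comp x y z (s : span y z) (r : span x y)
    (p : span (apex r) (apex s)) : span x z :=
  Span (lft r ∘ lft p) (rgt s ∘ rgt p).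

Definition basis_comp x y z (s : relation y z) (r : relation x y) : hom0 x z :=
  match pullback (rgt (relation_span r)) (lft (relation_span s)) with
  | inleft p => span_vec (span_comp (sval p))
  | inright _ => 0
  end.

Definition comp0 x y z (g : hom0 y z) (f : hom0 x y) : hom0 x z :=
  \sum_s \sum_r (g s * f r) *: basis_comp s r.

Definition graph x y (f : hom x y) : relation x y :=
  span_im (Span (idm x) f).
Definition cograph x y (f : hom x y) : relation y x :=
  span_im (Span f (idm x)).

Definition push x y (f : hom x y) : hom0 x y := basis (graph f).
Definition pull x y (f : hom x y) : hom0 y x := basis (cograph f).

Definition id0 x : hom0 x x := push (idm x).

Lemma degree_iso x y (f : hom x y) : is_iso f -> degree delta f = 1.
Proof.
move=> [g [gf fg]].
rewrite -(degree_id delta y).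
apply: (@degree_pullback delta _ _ _ (idm y) (idm y) (Span f f)).
  exact: surjective_id.
split=> // t a b; rewrite !ccomp1f => <-; exists (g ∘ a); split=> /=.
  by rewrite ccompA fg ccomp1f.
by move=> h [<- _]; rewrite ccompA gf ccomp1f.
Qed.

Lemma span_vecE x y (s : span x y) (r : relation x y)
    (e : hom (apex s) (apex (relation_span r))) :
  surjective e -> span_hom e -> span_vec s = degree delta e *: basis r.
Proof.
move=> Se se; have E := span_im_unique Se se.
rewrite /span_vec; case: r / E e Se se => e Se se.
by congr (degree _ _ *: _); exact: span_hom_unique (span_im_mapP s) se.
Qed.

Lemma span_hom_comp x y (s1 s2 s3 : span x y) (g : hom (apex s2) (apex s3))
    (f : hom (apex s1) (apex s2)) :
  span_hom g -> span_hom f -> span_hom (g ∘ f).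
Proof. by move=> [g1 g2] [f1 f2]; split; rewrite ccompA ?g1 ?g2. Qed.

Lemma span_vec_surj x y (s s' : span x y) (e : hom (apex s) (apex s')) :
  surjective e -> span_hom e -> span_vec s = degree delta e *: span_vec s'.
Proof.
move=> Se se; rewrite [in RHS]/span_vec scalerA mulrC.
rewrite -degree_comp //; last exact: span_im_map_surj.
apply: span_vecE; first by apply: surjective_comp => //; exact: span_im_map_surj.
by apply: span_hom_comp => //; exact: span_im_mapP.
Qed.

Lemma span_vec_iso x y (s s' : span x y) (e : hom (apex s) (apex s')) :
  is_iso e -> span_hom e -> span_vec s = span_vec s'.
Proof.
move=> Ie se; rewrite (span_vec_surj (iso_surjective Ie) se) degree_iso //.
by rewrite scale1r.
Qed.

Lemma basis_span_vec x y (r : relation x y) :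
  basis r = span_vec (relation_span r).
Proof.
rewrite (@span_vecE _ _ _ r (idm _)); first by rewrite degree_id scale1r.
- exact: surjective_id.
- by rewrite /span_hom !ccompf1.
Qed.

Lemma monic_span_vec x y (s : span x y) :
  (forall t (a b : hom t (apex s)),
     lft s ∘ a = lft s ∘ b -> rgt s ∘ a = rgt s ∘ b -> a = b) ->
  basis (span_im s) = span_vec s.
Proof.
move=> Ms; rewrite /span_vec degree_iso ?scale1r //.
apply: monic_surjective; last exact: span_im_map_surj.
move=> t a b ab; have [h1 h2] := span_im_mapP s.
by apply: Ms; rewrite -?h1 -?h2 -!ccompA ab.
Qed.

Lemma pushE x y (f : hom x y) : push f = span_vec (Span (idm x) f).
Proof. by apply: monic_span_vec => t a b /=; rewrite !ccomp1f. Qed.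

Lemma pullE x y (f : hom x y) : pull f = span_vec (Span f (idm x)).
Proof. by apply: monic_span_vec => t a b /=; rewrite !ccomp1f. Qed.

Lemma comp0_suml x y z I (P : seq I) (Q : pred I) (c : I -> K) (g : I -> hom0 y z) (f : hom0 x y) :
  comp0 (\sum_(i <- P | Q i) c i *: g i) f = \sum_(i <- P | Q i) c i *: comp0 (g i) f.
Proof.
rewrite /comp0 (eq_bigr _ (fun i _ => scaler_sumr _ _ _ _)) [RHS]exchange_big /=.
apply: eq_bigr => s _.
rewrite (eq_bigr _ (fun i _ => scaler_sumr _ _ _ _)) [RHS]exchange_big /=.
apply: eq_bigr => r _; rewrite sum_ffunE mulr_suml scaler_suml.
by apply: eq_bigr => i _; rewrite ffunE scalerA mulrA.
Qed.

Lemma comp0_sumr x y z I (P : seq I) (Q : pred I) (c : I -> K) (g : hom0 y z) (f : I -> hom0 x y) :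
  comp0 g (\sum_(i <- P | Q i) c i *: f i) = \sum_(i <- P | Q i) c i *: comp0 g (f i).
Proof.
rewrite /comp0 (eq_bigr _ (fun i _ => scaler_sumr _ _ _ _)) [RHS]exchange_big /=.
apply: eq_bigr => s _.
rewrite (eq_bigr _ (fun i _ => scaler_sumr _ _ _ _)) [RHS]exchange_big /=.
apply: eq_bigr => r _; rewrite sum_ffunE mulr_sumr scaler_suml.
by apply: eq_bigr => i _; rewrite ffunE scalerA mulrCA.
Qed.

Lemma comp0Zl x y z (c : K) (g : hom0 y z) (f : hom0 x y) :
  comp0 (c *: g) f = c *: comp0 g f.
Proof. by have := comp0_suml [:: tt] xpredT (fun=> c) (fun=> g) f; rewrite !big_cons !big_nil !addr0. Qed.

Lemma comp0Zr x y z (c : K) (g : hom0 y z) (f : hom0 x y) :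
  comp0 g (c *: f) = c *: comp0 g f.
Proof. by have := comp0_sumr [:: tt] xpredT (fun=> c) g (fun=> f); rewrite !big_cons !big_nil !addr0. Qed.

Lemma comp00l x y z (f : hom0 x y) : comp0 (0 : hom0 y z) f = 0.
Proof. by have := comp0Zl 0 (0 : hom0 y z) f; rewrite !scale0r. Qed.

Lemma comp00r x y z (g : hom0 y z) : comp0 g (0 : hom0 x y) = 0.
Proof. by have := comp0Zr 0 g (0 : hom0 x y); rewrite !scale0r. Qed.

Lemma comp0_basis x y z (s : relation y z) (r : relation x y) :
  comp0 (basis s) (basis r) = basis_comp s r.
Proof.
rewrite /comp0 (bigD1 s) //= [X in _ + X]big1 ?addr0 => [|s' s's].
  rewrite (bigD1 r) //= [X in _ + X]big1 ?addr0 => [|r' r'r].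
    by rewrite !ffunE !eqxx mulr1 scale1r.
  by rewrite !ffunE (negPf r'r) mulr0 scale0r.
by rewrite big1 // => r' _; rewrite !ffunE (negPf s's) mul0r scale0r.
Qed.

Lemma hom0_basis x y (f : hom0 x y) : f = \sum_r f r *: basis r.
Proof.
apply/ffunP => r; rewrite sum_ffunE (bigD1 r) //= [X in _ + X]big1 ?addr0 => [|s sr].
  by rewrite !ffunE eqxx; rewrite /GRing.scale /= mulr1.
by rewrite !ffunE eq_sym (negPf sr) /GRing.scale /= mulr0.
Qed.

Lemma pullback_iso x y z (f : hom x z) (g : hom y z) (P Q : span x y) :
  is_pullback f g P -> is_pullback f g Q ->
  exists2 h : hom (apex P) (apex Q), is_iso h & span_hom h.
Proof.
move=> HP HQ.
have [h [h12 _]] := proj2 HQ _ _ _ (proj1 HP).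
have [k [k12 _]] := proj2 HP _ _ _ (proj1 HQ).
exists h => //; exists k; case: h12 k12 => h1 h2 [k1 k2].
split; [apply: (pullback_ext HP) | apply: (pullback_ext HQ)];
  by rewrite ccompA ?h1 ?h2 ?k1 ?k2 ?h1 ?h2 ccompf1.
Qed.

Lemma comp0_span x y z (s : span y z) (r : span x y) (p : span (apex r) (apex s)) :
  is_pullback (rgt r) (lft s) p ->
  comp0 (span_vec s) (span_vec r) = span_vec (span_comp p).
Proof.
move=> Hp; rewrite [X in comp0 X]/span_vec [X in comp0 _ X]/span_vec.
rewrite comp0Zl comp0Zr comp0_basis scalerA /basis_comp.
set e := span_im_map r; set f := span_im_map s.
have [e1 e2] := span_im_mapP r; have [f1 f2] := span_im_mapP s.
have Se := span_im_map_surj r; have Sf := span_im_map_surj s.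
rewrite -/e -/f in e1 e2 f1 f2 Se Sf *.
set r' := relation_span _ in e e1 e2 Se *; set s' := relation_span _ in f f1 f2 Sf *.
case: pullback => [[q Hq] /=|nq]; last first.
  case: nq; apply: (regular_pullback (sf_regular A)).
  exists (apex p), (e ∘ lft p), (f ∘ rgt p).
  by rewrite !ccompA e2 f1 (proj1 Hp).
have [[w1 Hw1] Sw1] := regular_surjective (sf_regular A) (lft q) Se.
have {}Sw1 := Sw1 _ Hw1.
have [[w2 Hw2] Sw2] := regular_surjective (sf_regular A) (rgt q ∘ rgt w1) Sf.
have {}Sw2 := Sw2 _ Hw2.
pose w := Span (lft w1 ∘ rgt w2) (lft w2).
have Hw : is_pullback (rgt r) (lft s) w.
  split=> /= [|t a b ab].
    rewrite -e2 -f1 -!ccompA (ccompA _ _ (rgt w2)) (proj1 Hw1) (proj1 Hw2).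
    by rewrite !ccompA (proj1 Hq).
  have [|h [[h1 h2] _]] := proj2 Hq t (e ∘ a) (f ∘ b).
    by rewrite !ccompA e2 f1.
  have [|h' [[h'1 h'2] _]] := proj2 Hw1 t a h; first by rewrite h1.
  have [|k [[k1 k2] _]] := proj2 Hw2 t b h'; first by rewrite -ccompA h'2 h2.
  exists k; split=> [|k' [k'1 k'2]]; first by rewrite -ccompA k2.
  apply: (pullback_ext Hw2); rewrite ?k1 ?k'2 ?k2 //.
  apply: (pullback_ext Hw1); rewrite ?h'1 ?h'2 -?k'1 ?ccompA //.
  apply: (pullback_ext Hq).
    by rewrite h1 -k'1 !ccompA (proj1 Hw1).
  by rewrite h2 -k'2 !ccompA (proj1 Hw2).
have [h Ih [h1 h2]] := pullback_iso Hp Hw.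
rewrite (@span_vec_iso _ _ (span_comp p) (span_comp w) h) //; last first.
  by split=> /=; rewrite -ccompA -?h1 -?h2 //.
rewrite (@span_vec_surj _ _ (span_comp w) (span_comp q) (rgt w1 ∘ rgt w2)).
- rewrite degree_comp // (degree_pullback delta Sf Hw2).
  by rewrite (degree_pullback delta Se Hw1) mulrC.
- exact: surjective_comp.
- split=> /=.
    by rewrite -ccompA (ccompA (lft q)) -(proj1 Hw1) !ccompA e1.
  by rewrite -ccompA (ccompA (rgt q)) -(proj1 Hw2) !ccompA f2.
Qed.

Lemma comp0_span0 x y z (s : span y z) (r : span x y) :
  ~ (exists u (a : hom u (apex r)) (b : hom u (apex s)),
       rgt r ∘ a = lft s ∘ b) ->
  comp0 (span_vec s) (span_vec r) = 0.
Proof.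
move=> nu; rewrite comp0Zl comp0Zr comp0_basis /basis_comp.
case: pullback => [[q Hq]|_]; last by rewrite !scaler0.
case: nu.
have [e1 e2] := span_im_mapP r; have [f1 f2] := span_im_mapP s.
have [[w1 Hw1] _] :=
  regular_surjective (sf_regular A) (lft q) (span_im_map_surj r).
have [[w2 Hw2] _] :=
  regular_surjective (sf_regular A) (rgt q ∘ rgt w1) (span_im_map_surj s).
exists (apex w2), (lft w1 ∘ rgt w2), (lft w2).
rewrite -e2 -f1 -!ccompA (ccompA _ _ (rgt w2)) (proj1 Hw1) (proj1 Hw2).
by rewrite !ccompA (proj1 Hq).
Qed.

Lemma span_assoc x y z t (s3 : span z t) (s2 : span y z) (s1 : span x y) :
  comp0 (span_vec s3) (comp0 (span_vec s2) (span_vec s1)) =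
  comp0 (comp0 (span_vec s3) (span_vec s2)) (span_vec s1).
Proof.
case: (pselect (exists u (a : hom u (apex s1)) (b : hom u (apex s2))
    (c : hom u (apex s3)), rgt s1 ∘ a = lft s2 ∘ b /\ rgt s2 ∘ b = lft s3 ∘ c));
    last first.
  move=> nu; transitivity (0 : hom0 x t).
    case: (pselect (exists u (a : hom u (apex s1)) (b : hom u (apex s2)),
       rgt s1 ∘ a = lft s2 ∘ b)) => [/(regular_pullback (sf_regular A))[p Hp]|];
      last by move=> /comp0_span0 ->; rewrite comp00r.
    rewrite (comp0_span Hp); apply: comp0_span0 => -[u [a [b /= ab]]].
    case: nu; exists u, (lft p ∘ a), (rgt p ∘ a), b.
    by rewrite !ccompA (proj1 Hp) ab.
  case: (pselect (exists u (a : hom u (apex s2)) (b : hom u (apex s3)),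
       rgt s2 ∘ a = lft s3 ∘ b)) => [/(regular_pullback (sf_regular A))[p Hp]|];
      last by move=> /comp0_span0 ->; rewrite comp00l.
  rewrite (comp0_span Hp); apply/esym; apply: comp0_span0 => -[u [a [b /= ab]]].
  case: nu; exists u, a, (lft p ∘ b), (rgt p ∘ b).
  by rewrite !ccompA -(proj1 Hp) ab.
move=> [u [a [b [c [ab bc]]]]].
have [|p Hp] := @regular_pullback _ (sf_regular A) _ _ _ (rgt s1) (lft s2).
  by exists u, a, b.
have [|q Hq] := @regular_pullback _ (sf_regular A) _ _ _ (rgt s2) (lft s3).
  by exists u, b, c.
rewrite (comp0_span Hp) (comp0_span Hq).
have [|p' Hp'] := @regular_pullback _ (sf_regular A) _ _ _
    (rgt (span_comp p)) (lft s3).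
  have [h [[h1 h2] _]] := proj2 Hp _ _ _ ab.
  by exists u, h, c; rewrite /= -ccompA h2.
have [|q' Hq'] := @regular_pullback _ (sf_regular A) _ _ _
    (rgt s1) (lft (span_comp q)).
  have [h [[h1 h2] _]] := proj2 Hq _ _ _ bc.
  by exists u, a, h; rewrite /= -ccompA h1.
rewrite (comp0_span Hp') (comp0_span Hq').
have /= Ep' := proj1 Hp'; have /= Eq' := proj1 Hq'.
have [|h [[h1 h2] _]] := proj2 Hq _ (rgt p ∘ lft p') (rgt p').
  by rewrite -Ep' ccompA.
have [|h' [[h'1 h'2] _]] := proj2 Hq' _ (lft p ∘ lft p') h.
  by rewrite /= -ccompA h1 !ccompA (proj1 Hp).
have [|k [[k1 k2] _]] := proj2 Hp _ (lft q') (lft q ∘ rgt q').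
  by rewrite Eq' ccompA.
have [|k' [[k'1 k'2] _]] := proj2 Hp' _ k (rgt q ∘ rgt q').
  by rewrite /= -ccompA k2 !ccompA (proj1 Hq).
apply: (@span_vec_iso _ _ (span_comp p') (span_comp q') h'); last first.
  by split; rewrite /= -!ccompA ?h'1 ?h'2 ?h2.
exists k'; split.
  apply: (pullback_ext Hp').
    rewrite ccompf1 ccompA k'1; apply: (pullback_ext Hp).
      by rewrite ccompA k1 h'1.
    by rewrite ccompA k2 -ccompA h'2 h1.
  by rewrite ccompf1 ccompA k'2 -ccompA h'2 h2.
apply: (pullback_ext Hq').
  by rewrite ccompf1 ccompA h'1 -ccompA k'1 k1.
rewrite ccompf1 ccompA h'2; apply: (pullback_ext Hq).
  by rewrite ccompA h1 -ccompA k'1 k2.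
by rewrite ccompA h2 k'2.
Qed.

Lemma comp0A x y z t (h : hom0 z t) (g : hom0 y z) (f : hom0 x y) :
  comp0 h (comp0 g f) = comp0 (comp0 h g) f.
Proof.
rewrite (hom0_basis h) (hom0_basis g) (hom0_basis f).
rewrite !comp0_suml; apply: eq_bigr => s3 _; congr (_ *: _).
rewrite [LHS]comp0_sumr [X in _ = comp0 X _]comp0_sumr comp0_suml.
apply: eq_bigr => s2 _; congr (_ *: _).
rewrite !comp0_sumr; apply: eq_bigr => s1 _; congr (_ *: _).
by rewrite !basis_span_vec span_assoc.
Qed.

Lemma comp1_span x y (s : span x y) : comp0 (id0 y) (span_vec s) = span_vec s.
Proof.
rewrite /id0 pushE (@comp0_span x y y (Span (idm y) (idm y)) s
  (Span (idm _) (rgt s))).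
  set w := span_comp _; apply: (@span_vec_iso _ _ w s (idm (apex s))).
    by exists (idm _); rewrite !ccompf1.
  by split; rewrite /= !(ccompf1, ccomp1f).
split=> [|t a b /=]; first by rewrite /= ccompf1 ccomp1f.
rewrite ccomp1f => ab; exists a; split=> [|h [<- _]]; last by rewrite ccomp1f.
by rewrite ccomp1f ab.
Qed.

Lemma comp_span1 x y (s : span x y) : comp0 (span_vec s) (id0 x) = span_vec s.
Proof.
rewrite /id0 pushE (@comp0_span x x y s (Span (idm x) (idm x))
  (Span (lft s) (idm _))).
  set w := span_comp _; apply: (@span_vec_iso _ _ w s (idm (apex s))).
    by exists (idm _); rewrite !ccompf1.
  by split; rewrite /= !(ccompf1, ccomp1f).
split=> [|t a b /=]; first by rewrite /= ccompf1 ccomp1f.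
rewrite ccomp1f => ab; exists b; split=> [|h [_ <-]]; last by rewrite ccomp1f.
by rewrite ccomp1f ab.
Qed.

Lemma comp01f x y (f : hom0 x y) : comp0 (id0 y) f = f.
Proof.
rewrite [in RHS](hom0_basis f) (hom0_basis f) comp0_sumr.
by apply: eq_bigr => r _; rewrite -hom0_basis basis_span_vec comp1_span.
Qed.

Lemma comp0f1 x y (f : hom0 x y) : comp0 f (id0 x) = f.
Proof.
rewrite [in RHS](hom0_basis f) (hom0_basis f) comp0_suml.
by apply: eq_bigr => r _; rewrite -hom0_basis basis_span_vec comp_span1.
Qed.

Definition T0cat : category := Category comp01f comp0f1 comp0A.

End Tensor.

Section Mobius.
Variables (d : Order.disp_t) (T : porderType d).
Local Open Scope order_scope.
Implicit Types a b c : T.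

Definition interval_size a b := #|` fset_set [set c : T | (a <= c <= b)%O]|%fset.

(* The Moebius function of a poset with finite intervals: [mobius ^~ b] is
   determined by [sum_(a <= c <= b) mobius c b = (a == b)].  The counter [n] is
   only there to make the recursion on the size of [a, b] structural. *)
Fixpoint mobius_rec (n : nat) a b : int :=
  if n is m.+1 then
    if a == b then 1%R
    else if a < b then
      (- \sum_(c \in [set c : T | (a < c <= b)%O]) mobius_rec m c b)%R
    else 0%R
  else 0%R.

Definition mobius a b : int := mobius_rec (interval_size a b) a b.

Lemma interval_size_lt a b c : finite_set [set c : T | (a <= c <= b)%O] ->
  a < c -> c <= b -> finite_set [set e : T | c <= e <= b] /\
  (interval_size c b < interval_size a b)%N.
Proof.
move=> fab ac cb.
have sub : ([set e : T | c <= e <= b] `<=` [set e : T | a <= e <= b])%classic.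
  by move=> e /= /andP[ce ->]; rewrite (le_trans (ltW ac) ce).
have fcb := sub_finite_set sub fab; split=> //.
apply: fproper_ltn_card; rewrite fproperE; apply/andP; split.
  by apply/fsubsetP => e; rewrite !in_fset_set // !inE => /sub.
apply/negP => /fsubsetP/(_ a); rewrite !in_fset_set // !inE /=.
by rewrite lexx (le_trans (ltW ac) cb) (lt_geF ac) => /(_ isT).
Qed.

Lemma interval_size_gt0 a b : finite_set [set c : T | (a <= c <= b)%O] ->
  a <= b -> (0 < interval_size a b)%N.
Proof.
move=> fab ab; rewrite cardfs_gt0; apply/fset0Pn; exists a.
by rewrite in_fset_set // inE /= lexx.
Qed.

Lemma mobius_rec_stable m n a b : finite_set [set c : T | (a <= c <= b)%O] ->
  (interval_size a b <= m)%N -> (interval_size a b <= n)%N ->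
  mobius_rec m a b = mobius_rec n a b.
Proof.
elim: m n a b => [|m IH] [|n] a b fab //=.
- move=> s0 _; case: eqP => [ab|_].
    by have := interval_size_gt0 fab; rewrite ltnNge s0 ab lexx => /(_ isT).
  by case: ifP => // /ltW/(interval_size_gt0 fab); rewrite ltnNge s0.
- move=> _ s0; case: eqP => [ab|_].
    by have := interval_size_gt0 fab; rewrite ltnNge s0 ab lexx => /(_ isT).
  by case: ifP => // /ltW/(interval_size_gt0 fab); rewrite ltnNge s0.
move=> sm sn; case: eqP => // _; case: ifP => // ab; congr (- _)%R.
apply: eq_fsbigr => c; rewrite inE /= => /andP[ac cb].
have [fcb lt] := interval_size_lt fab ac cb.
by apply: IH => //; rewrite -ltnS (leq_trans lt).
Qed.

Lemma mobiusE a b : finite_set [set c : T | (a <= c <= b)%O] ->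
  mobius a b = if a == b then 1%R else if a < b then
    (- \sum_(c \in [set c : T | (a < c <= b)%O]) mobius c b)%R else 0%R.
Proof.
move=> fab; rewrite /mobius.
rewrite (@mobius_rec_stable _ (interval_size a b).+1) //=.
case: eqP => // _; case: ifP => // ab; congr (- _)%R.
apply: eq_fsbigr => c; rewrite inE /= => /andP[ac cb].
have [fcb lt] := interval_size_lt fab ac cb.
by apply: mobius_rec_stable => //; rewrite ltnW.
Qed.

Lemma mobius_sum a b : finite_set [set c : T | (a <= c <= b)%O] -> a <= b ->
  (\sum_(c \in [set c : T | (a <= c <= b)%O]) mobius c b = (a == b)%:R)%R.
Proof.
move=> fab ab; rewrite (fsbigD1 a) //=; last by rewrite lexx.
rewrite mobiusE //.
have -> : ([set c : T | (a <= c <= b)%O] `\ a = [set c : T | (a < c <= b)%O])%classic.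
  apply/seteqP; split=> c /=; rewrite lt_neqAle.
    by move=> [/andP[-> ->] /eqP ca]; rewrite eq_sym ca.
  by move=> /andP[/andP[/eqP ca ->] ->]; split=> // /esym.
have [<-|ne] := eqVneq a b.
  rewrite fsbig1 ?addr0 // => c /= /andP[ac ca].
  by have := lt_le_trans ac ca; rewrite ltxx.
by rewrite lt_neqAle ne ab addNr.
Qed.

End Mobius.

Section Star.
Variables (A : sf_regular_category) (K : fieldType).
Variable delta : degree_function A K.
Implicit Types x y z t : A.

Notation hom0 x y := {ffun relation x y -> K^o}.
Local Notation comp0 := (comp0 delta).

Definition p_ x (u : sub x) : hom0 x x := comp0 (push K (subm u)) (pull K (subm u)).

Definition pstar x (v : sub x) : hom0 x x :=
  \sum_(u : sub x | (u <= v)%O) (mobius u v)%:~R *: p_ u.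

Definition omega x y (e : hom x y) : K :=
  \sum_(u : sub x | im (e ∘ subm u) == sub_top y)
    (mobius u (sub_top x))%:~R * degree delta (e ∘ subm u).

Lemma sub_finite x (P : set (sub x)) : finite_set P.
Proof. exact: sub_finite_set (sf_finite x). Qed.

Lemma mobius_sumT x (a b : sub x) : (a <= b)%O ->
  \sum_(c | (a <= c <= b)%O) mobius c b = (a == b)%:R.
Proof.
move=> ab; rewrite -mobius_sum //; last exact: sub_finite.
by rewrite bigfs ?index_enum_uniq // => c _; rewrite mem_index_enum.
Qed.

Lemma sub_leP x (u v : sub x) : reflect (factors (subm u) (subm v)) (u <= v)%O.
Proof. exact: asboolP. Qed.

Lemma sub_le_top x (u : sub x) : (u <= sub_top x)%O.
Proof.
apply/sub_leP; apply: (factors_trans _ (proj1 (sub_ofK (mono_id x)))).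
by exists (subm u); rewrite /= ccomp1f.
Qed.

Lemma p_E x (u : sub x) : p_ u = span_vec delta (Span (subm u : hom _ _) (subm u)).
Proof.
rewrite /p_ (pushE delta) (pullE delta).
have Hp : is_pullback (idm (mdom (subm u))) (idm _) (Span (idm _) (idm _)).
  split=> // t a b; rewrite !ccomp1f => <-.
  exists a; split=> [|h [<- _]] /=; by rewrite ccomp1f.
rewrite (comp0_span delta (r := Span (subm u : hom _ _) (idm _))
   (s := Span (idm _) (subm u : hom _ _)) Hp).
by rewrite /span_comp /= !ccompf1.
Qed.

Definition is_meet x (u v w : sub x) :=
  forall c : sub x, (c <= w)%O = (c <= u)%O && (c <= v)%O.

Lemma p_mono x (u : sub x) (m : mono x) : sub_of m = u ->
  span_vec delta (Span (m : hom _ _) m) = p_ u.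
Proof.
move=> <-; have [[h hE] [k kE]] := sub_ofK m; rewrite p_E.
apply: (@span_vec_iso _ _ _ _ _ (Span (m : hom _ _) m) (Span _ _) h) => //.
by exists k; split; apply: mmapP; rewrite ccompA ?hE ?kE ?hE ccompf1.
Qed.

Lemma p_comp x (u v : sub x) :
  (comp0 (p_ u) (p_ v) = 0 /\ forall c : sub x, ~~ ((c <= u)%O && (c <= v)%O)) \/
  exists2 w, is_meet u v w & comp0 (p_ u) (p_ v) = p_ w.
Proof.
rewrite !p_E.
case: (pselect (exists t (a : hom t (mdom (subm v))) (b : hom t (mdom (subm u))),
  subm v ∘ a = subm u ∘ b)) => [/(regular_pullback (sf_regular A))[q Hq]|nt].
  right; have Mq : monic (subm v ∘ lft q).
    apply: monic_comp; first exact: mmapP.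
    by apply: (pullback_monic Hq); exact: mmapP.
  exists (sub_of (Mono Mq)).
    have [s1 s2] := sub_ofK (Mono Mq) => c.
    apply/sub_leP/andP => [cq|[/sub_leP[a aE] /sub_leP[b bE]]].
      have [h /= hE] := factors_trans cq s2.
      split; apply/sub_leP; last by exists (lft q ∘ h); rewrite ccompA.
      by exists (rgt q ∘ h); rewrite ccompA -(proj1 Hq).
    apply: factors_trans s1.
    have [|h [[h1 h2] _]] := proj2 Hq _ b a; first by rewrite aE bE.
    by exists h; rewrite /= -ccompA h1.
  rewrite (comp0_span delta (s := Span _ _) (r := Span _ _) Hq).
  by rewrite -(p_mono (erefl (sub_of (Mono Mq)))) /span_comp /= -(proj1 Hq).
left; split; first exact: comp0_span0.
move=> c; apply/negP => /andP[/sub_leP[a aE] /sub_leP[b bE]].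
by apply: nt; exists (mdom (subm c)), b, a; rewrite aE bE.
Qed.

Lemma p_top x : p_ (sub_top x) = id0 K x.
Proof. by rewrite /id0 (pushE delta) -(p_mono (erefl (sub_of (mono_id x)))). Qed.

(* Weisner's theorem on the poset [sub x], where meets may be missing. *)
Lemma weisner x (v : sub x) (F : sub x -> option (sub x)) :
  v != sub_top x ->
  (forall u w, F u = Some w <-> is_meet v u w) ->
  (forall u, F u = None -> forall c : sub x, ~~ ((c <= v)%O && (c <= u)%O)) ->
  forall w, \sum_(u | F u == Some w) mobius u (sub_top x) = 0.
Proof.
move=> vT FS FN w.
have Fv u w' : F u == Some w' -> (w' <= v)%O.
  move/eqP/FS=> m; have : (w' <= w')%O by [].
  by rewrite m => /andP[].
have [wv|wv] := boolP (w <= v)%O; last first.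
  by rewrite big_pred0 // => u; apply/negP => /Fv; apply/negP.
have [n] := ubnP #|[pred c : sub x | (w <= c)%O]|.
elim: n => // n IH in w wv *; rewrite ltnS => wn.
have := mobius_sumT (sub_le_top w); rewrite (_ : (w == _) = false); last first.
  apply: contraNF vT => /eqP wT; rewrite eq_le sub_le_top /=.
  by rewrite -[X in (X <= _)%O]wT.
rewrite (eq_bigl (fun u => (w <= u)%O)) => [|u]; last by rewrite sub_le_top andbT.
rewrite (partition_big (fun u => odflt v (F u)) (fun w' => (w <= w' <= v)%O)) /=;
  last first.
  move=> u wu; case E: (F u) => [w'|] /=; last by rewrite wv lexx.
  by rewrite (Fv u) ?E // andbT ((FS _ _).1 E) wv wu.
have FE w' u : (w <= w' <= v)%O ->
    (w <= u)%O && (odflt v (F u) == w') = (F u == Some w').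
  move=> /andP[ww' w'v]; case E: (F u) => [c|] /=.
    rewrite (inj_eq Some_inj); case: eqP => [cw|]; rewrite ?andbF // andbT.
    by move: ww'; rewrite -cw ((FS _ _).1 E) => /andP[_ ->].
  by apply/negP => /andP[wu _]; have := FN _ E w; rewrite wv wu.
under eq_bigr => w' ww' do under eq_bigl => u do rewrite FE //.
rewrite (bigD1 w) ?lexx ?wv //= [X in _ + X]big1 ?addr0 // => w' /andP[/andP[ww' w'v] ne].
apply: IH => //; apply: leq_trans wn; apply: proper_card.
apply/properP; split; first by apply/fintype.subsetP => c; rewrite /in_mem /= => w'c; exact: (le_trans ww' w'c).
exists w; rewrite /in_mem /= ?lexx //.
by rewrite lt_geF // lt_neqAle eq_sym ne.
Qed.

Lemma p_pstar x (v : sub x) : v != sub_top x ->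
  comp0 (p_ v) (pstar (sub_top x)) = 0.
Proof.
move=> vT; rewrite /pstar (comp0_sumr delta).
pose F u := if pselect (exists w, is_meet v u w) is left h then
  Some (sval (cid h)) else None.
have meet_unique u w w' : is_meet v u w -> is_meet v u w' -> w = w'.
  by move=> m m'; apply/eqP; rewrite eq_le m' -m lexx /= m -m' lexx.
have FS u w : F u = Some w <-> is_meet v u w.
  rewrite /F; case: pselect => [h|nh]; last by split=> // m; case: nh; exists w.
  case: cid => w' m /=; split=> [[<-] //|m']; congr Some.
  exact: meet_unique m m'.
have FN u : F u = None -> comp0 (p_ v) (p_ u) = 0 /\
    forall c : sub x, ~~ ((c <= v)%O && (c <= u)%O).
  move=> Fu; have [//|[w /FS]] := p_comp v u; by rewrite Fu.
have FE u w : F u = Some w -> comp0 (p_ v) (p_ u) = p_ w.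
  move=> /FS m; have [[_ /(_ w)]|[w' m' ->]] := p_comp v u.
    by rewrite -m lexx.
  by congr p_; exact: meet_unique m' m.
rewrite (eq_bigl xpredT) => [|u]; last by rewrite sub_le_top.
rewrite (partition_big F xpredT) //= big1 // => -[w|] _.
  under eq_bigr => u /eqP/FE -> do over.
  rewrite -scaler_suml -rmorph_sum /= (weisner vT FS) ?scale0r // => u.
  by case/FN.
by apply: big1 => u /eqP/FN[-> _]; rewrite scaler0.
Qed.

Lemma pstar_idem x :
  comp0 (pstar (sub_top x)) (pstar (sub_top x)) = pstar (sub_top x).
Proof.
rewrite [X in comp0 X]/pstar (comp0_suml delta) (bigD1 (sub_top x)) //=.
rewrite big1 ?addr0 => [|u /andP[_ uT]]; last by rewrite p_pstar // scaler0.
rewrite p_top (comp01f delta) mobiusE ?eqxx ?scale1r //.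
exact: sub_finite.
Qed.

End Star.

Section PseudoAbelian.
Variables (A : sf_regular_category) (K : fieldType).
Variable delta : degree_function A K.
Implicit Types x y z t : A.

Notation hom0 x y := {ffun relation x y -> K^o}.
Local Notation comp0 := (comp0 delta).

(* The direct sum of the spaces Hom([X i], [Y j]), given by its basis. *)
Definition mat_basis m n (X : 'I_m -> A) (Y : 'I_n -> A) : finType :=
  {ij : 'I_m * 'I_n & relation (X ij.1) (Y ij.2)}.

Notation mat X Y := {ffun mat_basis X Y -> K^o}.

Definition entry m n (X : 'I_m -> A) (Y : 'I_n -> A) (f : mat X Y)
    (i : 'I_m) (j : 'I_n) : hom0 (X i) (Y j) :=
  [ffun r => f (existT (fun ij => relation (X ij.1) (Y ij.2)) (i, j) r)].

Definition mat_of m n (X : 'I_m -> A) (Y : 'I_n -> A)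
    (f : forall i j, hom0 (X i) (Y j)) : mat X Y :=
  [ffun t => f (tag t).1 (tag t).2 (tagged t)].

Definition mat_comp l m n (X : 'I_l -> A) (Y : 'I_m -> A) (Z : 'I_n -> A)
    (g : mat Y Z) (f : mat X Y) : mat X Z :=
  mat_of (fun i k => \sum_j comp0 (entry g j k) (entry f i j)).

Record Tobj := TObj {
  Tsize : nat;
  Tsum : 'I_Tsize -> A;
  Tproj : mat Tsum Tsum;
  Tproj_idem : mat_comp Tproj Tproj = Tproj }.

Arguments Tsum : clear implicits.

Lemma entry_mat_of m n (X : 'I_m -> A) (Y : 'I_n -> A)
    (f : forall i j, hom0 (X i) (Y j)) i j : entry (mat_of f) i j = f i j.
Proof. by apply/ffunP => r; rewrite !ffunE. Qed.

Lemma mat_ext m n (X : 'I_m -> A) (Y : 'I_n -> A) (f g : mat X Y) :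
  (forall i j, entry f i j = entry g i j) -> f = g.
Proof.
move=> fg; apply/ffunP => -[[i j] r].
by have /ffunP/(_ r) := fg i j; rewrite !ffunE.
Qed.

Lemma mat_compA k l m n (X : 'I_k -> A) (Y : 'I_l -> A) (Z : 'I_m -> A)
    (W : 'I_n -> A) (h : mat Z W) (g : mat Y Z) (f : mat X Y) :
  mat_comp h (mat_comp g f) = mat_comp (mat_comp h g) f.
Proof.
apply: mat_ext => i j; rewrite !entry_mat_of.
under eq_bigr => c _.
  rewrite entry_mat_of; under eq_bigr => b _ do rewrite -[comp0 _ _]scale1r.
  rewrite comp0_sumr; under eq_bigr => b _ do rewrite scale1r comp0A.
  over.
under [RHS]eq_bigr => b _.
  rewrite entry_mat_of; under eq_bigr => c _ do rewrite -[comp0 _ _]scale1r.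
  rewrite comp0_suml; under eq_bigr => c _ do rewrite scale1r.
  over.
by rewrite exchange_big.
Qed.

Lemma entryD m n (X : 'I_m -> A) (Y : 'I_n -> A) a (f g : mat X Y) i j :
  entry (a *: f + g) i j = a *: entry f i j + entry g i j.
Proof. by apply/ffunP => r; rewrite !ffunE. Qed.

Lemma comp0_linl x y z a (g g' : hom0 y z) (f : hom0 x y) :
  comp0 (a *: g + g') f = a *: comp0 g f + comp0 g' f.
Proof.
have := comp0_suml delta [:: true; false] xpredT (fun b => if b then a else 1)
  (fun b => if b then g else g') f.
by rewrite !big_cons !big_nil !addr0 !scale1r.
Qed.

Lemma comp0_linr x y z a (g : hom0 y z) (f f' : hom0 x y) :
  comp0 g (a *: f + f') = a *: comp0 g f + comp0 g f'.
Proof.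
have := comp0_sumr delta [:: true; false] xpredT (fun b => if b then a else 1)
  g (fun b => if b then f else f').
by rewrite !big_cons !big_nil !addr0 !scale1r.
Qed.

Lemma mat_comp_linl l m n (X : 'I_l -> A) (Y : 'I_m -> A) (Z : 'I_n -> A)
    (a : K) (g g' : mat Y Z) (f : mat X Y) :
  mat_comp (a *: g + g') f = a *: mat_comp g f + mat_comp g' f.
Proof.
apply: mat_ext => i j; rewrite entryD !entry_mat_of scaler_sumr -big_split /=.
by apply: eq_bigr => c _; rewrite entryD comp0_linl.
Qed.

Lemma mat_comp_linr l m n (X : 'I_l -> A) (Y : 'I_m -> A) (Z : 'I_n -> A)
    (a : K) (g : mat Y Z) (f f' : mat X Y) :
  mat_comp g (a *: f + f') = a *: mat_comp g f + mat_comp g f'.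
Proof.
apply: mat_ext => i j; rewrite entryD !entry_mat_of scaler_sumr -big_split /=.
by apply: eq_bigr => c _; rewrite entryD comp0_linr.
Qed.

Section Hom.
Variables P Q : Tobj.

Definition sandwich (f : mat (Tsum P) (Tsum Q)) : mat (Tsum P) (Tsum Q) :=
  mat_comp (Tproj Q) (mat_comp f (Tproj P)).

Lemma sandwich_linear : linear sandwich.
Proof. by move=> a f g; rewrite /sandwich mat_comp_linl mat_comp_linr. Qed.

HB.instance Definition _ := GRing.isLinear.Build K _ _ _ sandwich sandwich_linear.

(* Hom(pX, qY) = q Hom(X, Y) p *)
Definition Thom_space : {vspace mat (Tsum P) (Tsum Q)} := limg (linfun sandwich).
Definition Thom : vectType K := subvs_of Thom_space.

Lemma sandwich_idem f : sandwich (sandwich f) = sandwich f.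
Proof.
rewrite /sandwich -!mat_compA Tproj_idem (mat_compA _ (Tproj Q)) Tproj_idem.
by [].
Qed.

Lemma mem_Thom f : (f \in Thom_space) = (sandwich f == f).
Proof.
apply/memv_imgP/eqP => [[g _ ->]|fE].
  by rewrite lfunE /= sandwich_idem.
by exists f; rewrite ?memvf // lfunE /= fE.
Qed.

Lemma sandwich_in f : sandwich f \in Thom_space.
Proof. by rewrite mem_Thom sandwich_idem. Qed.
End Hom.

Lemma Tproj_left P Q (f : Thom P Q) : mat_comp (Tproj Q) (vsval f) = vsval f.
Proof.
have := subvsP f; rewrite mem_Thom /sandwich => /eqP {1}<-.
by rewrite mat_compA Tproj_idem -[in RHS](eqP (etrans (esym (mem_Thom _)) (subvsP f))).
Qed.

Lemma Tproj_right P Q (f : Thom P Q) : mat_comp (vsval f) (Tproj P) = vsval f.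
Proof.
have := subvsP f; rewrite mem_Thom /sandwich => /eqP E.
by rewrite -{1}E -!mat_compA Tproj_idem.
Qed.

Lemma Tcomp_in P Q R (g : Thom Q R) (f : Thom P Q) :
  mat_comp (vsval g) (vsval f) \in Thom_space P R.
Proof.
by rewrite mem_Thom /sandwich -mat_compA Tproj_right mat_compA Tproj_left.
Qed.

Lemma Tid_in P : Tproj P \in Thom_space P P.
Proof. by rewrite mem_Thom /sandwich !Tproj_idem. Qed.

Definition Tcomp P Q R (g : Thom Q R) (f : Thom P Q) : Thom P R :=
  Subvs (Tcomp_in g f).

Definition Tid P : Thom P P := Subvs (Tid_in P).

Lemma Tcomp1f P Q (f : Thom P Q) : Tcomp (Tid Q) f = f.
Proof. by apply: val_inj; exact: Tproj_left. Qed.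

Lemma Tcompf1 P Q (f : Thom P Q) : Tcomp f (Tid P) = f.
Proof. by apply: val_inj; exact: Tproj_right. Qed.

Lemma TcompA P Q R S (h : Thom R S) (g : Thom Q R) (f : Thom P Q) :
  Tcomp h (Tcomp g f) = Tcomp (Tcomp h g) f.
Proof. by apply: val_inj; exact: mat_compA. Qed.

Definition Tcat : category := Category Tcomp1f Tcompf1 TcompA.

Definition mat1 x y (f : hom0 x y) : mat (fun _ : 'I_1 => x) (fun _ : 'I_1 => y) :=
  mat_of (fun _ _ => f).

Lemma mat1_comp x y z (g : hom0 y z) (f : hom0 x y) :
  mat_comp (mat1 g) (mat1 f) = mat1 (comp0 g f).
Proof.
by apply: mat_ext => i j; rewrite !entry_mat_of big_ord1 !entry_mat_of.
Qed.

Lemma star_idem x :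
  let p := mat1 (pstar delta (sub_top x)) in mat_comp p p = p.
Proof. by rewrite /= mat1_comp pstar_idem. Qed.

Definition star x : Tobj := TObj (star_idem x).

Definition star_hom x y (f : hom0 x y) : Thom (star x) (star y) :=
  Subvs (@sandwich_in (star x) (star y) (mat1 f)).

Lemma star_homE x y (f : hom0 x y) : vsval (star_hom f) =
  mat1 (comp0 (pstar delta (sub_top y)) (comp0 f (pstar delta (sub_top x)))).
Proof. by rewrite /= /sandwich /= !mat1_comp. Qed.

End PseudoAbelian.

Section Quotients.
Variable A : sf_regular_category.
Implicit Types x y z : A.

Record qdiagram x y := QDiagram {
  qapex : A;
  qlft : hom x qapex;
  qrgt : hom y qapex;
  qlft_surj : surjective qlft;
  qrgt_surj : surjective qrgt }.

HB.instance Definition _ x y := gen_eqMixin (qdiagram x y).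
HB.instance Definition _ x y := gen_choiceMixin (qdiagram x y).

Definition qhom x y (u v : qdiagram x y) (h : hom (qapex u) (qapex v)) :=
  h ∘ qlft u = qlft v /\ h ∘ qrgt u = qrgt v.

Definition qdiagram_equiv x y : rel (qdiagram x y) :=
  fun u v => `[< exists h : hom (qapex u) (qapex v), is_iso h /\ qhom h >].

Lemma qhom_comp x y (u v w : qdiagram x y) (g : hom (qapex v) (qapex w))
    (f : hom (qapex u) (qapex v)) : qhom g -> qhom f -> qhom (g ∘ f).
Proof. by move=> [g1 g2] [f1 f2]; split; rewrite -ccompA ?f1 ?f2. Qed.

Lemma qhom_id x y (u : qdiagram x y) : qhom (idm (qapex u)).
Proof. by split; rewrite ccomp1f. Qed.

Lemma qhom_unique x y (u v : qdiagram x y) (f g : hom (qapex u) (qapex v)) :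
  qhom f -> qhom g -> f = g.
Proof.
by move=> [f1 _] [g1 _]; apply: (surjective_epic (qlft_surj u)); rewrite f1 g1.
Qed.

Lemma qdiagram_equivP x y (u v : qdiagram x y) :
  reflect ((exists h : hom (qapex u) (qapex v), qhom h) /\
           (exists h : hom (qapex v) (qapex u), qhom h)) (qdiagram_equiv u v).
Proof.
apply: (iffP (asboolP _)) => [[h [[k [kh hk]] hq]]|[[h hq] [k kq]]].
  split; [by exists h | exists k].
  by split; rewrite -?(proj1 hq) -?(proj2 hq) ccompA kh ccomp1f.
exists h; split=> //; exists k; split.
  by apply: qhom_unique (qhom_id u); exact: qhom_comp.
by apply: qhom_unique (qhom_id v); exact: qhom_comp.
Qed.

Lemma qdiagram_equiv_refl x y : reflexive (@qdiagram_equiv x y).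
Proof. by move=> u; apply/qdiagram_equivP; split; exists (idm _); exact: qhom_id. Qed.

Lemma qdiagram_equiv_sym x y : symmetric (@qdiagram_equiv x y).
Proof. by move=> u v; apply/qdiagram_equivP/qdiagram_equivP => -[]. Qed.

Lemma qdiagram_equiv_trans x y : transitive (@qdiagram_equiv x y).
Proof.
move=> v u w /qdiagram_equivP[[h hq] [h' hq']] /qdiagram_equivP[[k kq] [k' kq']].
apply/qdiagram_equivP; split; first by exists (k ∘ h); exact: qhom_comp.
by exists (h' ∘ k'); exact: qhom_comp.
Qed.

Canonical qdiagram_equiv_rel x y := EquivRel (@qdiagram_equiv x y)
  (@qdiagram_equiv_refl x y) (@qdiagram_equiv_sym x y)
  (@qdiagram_equiv_trans x y).

Definition Rq x y := {eq_quot (qdiagram_equiv_rel x y)}.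
HB.instance Definition _ x y := Choice.on (Rq x y).

Definition Rq_of x y (u : qdiagram x y) : Rq x y := \pi_(Rq x y) u.

Definition Rq_le x y (u v : Rq x y) :=
  `[< exists h : hom (qapex (repr u)) (qapex (repr v)), qhom h >].

Lemma Rq_ofP x y (u v : qdiagram x y) :
  (Rq_of u = Rq_of v) <->
  (exists h : hom (qapex u) (qapex v), qhom h) /\
  (exists h : hom (qapex v) (qapex u), qhom h).
Proof.
by split=> [/eqmodP/qdiagram_equivP|] // h; apply/eqmodP/qdiagram_equivP.
Qed.

Lemma Rq_le_refl x y : reflexive (@Rq_le x y).
Proof. by move=> u; apply/asboolP; exists (idm _); exact: qhom_id. Qed.

Lemma Rq_le_anti x y : antisymmetric (@Rq_le x y).
Proof.
move=> u v /andP[/asboolP h1 /asboolP h2].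
by rewrite -(reprK u) -(reprK v); apply/Rq_ofP.
Qed.

Lemma Rq_le_trans x y : transitive (@Rq_le x y).
Proof.
move=> v u w /asboolP[h hq] /asboolP[k kq]; apply/asboolP.
by exists (k ∘ h); exact: qhom_comp.
Qed.

Fact Rq_display : Order.disp_t. Proof. exact: Order.Disp tt tt. Qed.
HB.instance Definition _ x y := Order.isPOrder.Build Rq_display (Rq x y)
  (fun _ _ => erefl) (@Rq_le_refl x y) (@Rq_le_anti x y) (@Rq_le_trans x y).

(* [x ->> u <<- y] and [y ->> v <<- z] turn [u ->> t <<- v] into
   [x ->> t <<- z]. *)
Definition qdiagram_comp x y z (u : qdiagram x y) (v : qdiagram y z)
    (t : qdiagram (qapex u) (qapex v)) : qdiagram x z :=
  QDiagram (surjective_comp (qlft_surj t) (qlft_surj u))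
           (surjective_comp (qrgt_surj t) (qrgt_surj v)).

Definition Rq_comp x y z (u : qdiagram x y) (v : qdiagram y z)
    (t : Rq (qapex u) (qapex v)) : Rq x z :=
  Rq_of (qdiagram_comp (repr t)).

Definition is_pushout x y z (f : hom y x) (g : hom y z) (w : qdiagram x z) :=
  qlft w ∘ f = qrgt w ∘ g /\
  forall t (a : hom x t) (b : hom z t), a ∘ f = b ∘ g ->
    exists! h : hom (qapex w) t, h ∘ qlft w = a /\ h ∘ qrgt w = b.

Lemma pushout_surjective x y z w (f : hom y x) (g : hom y z)
    (a : hom x w) (b : hom z w) :
  surjective f -> surjective g -> a ∘ f = b ∘ g ->
  (forall t (a' : hom x t) (b' : hom z t), a' ∘ f = b' ∘ g ->
    exists! h : hom w t, h ∘ a = a' /\ h ∘ b = b') ->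
  surjective a /\ surjective b.
Proof.
move=> Sf Sg ab U.
have key (n : mono w) : (exists a', n ∘ a' = a) -> (exists b', n ∘ b' = b) ->
    exists k, n ∘ k = idm w.
  move=> [a' aE] [b' bE].
  have [|h [[h1 h2] _]] := U _ a' b'.
    by apply: (@mmapP _ _ n); rewrite !ccompA aE bE.
  exists h; have [k [_ kU]] := U _ a b ab.
  by rewrite -(kU (n ∘ h)) ?(kU (idm w)) // ?ccomp1f // -!ccompA h1 h2.
have fact (y1 y2 : A) (e : hom y1 y2) (c : hom y2 w) (n : mono w) :
    surjective e -> (exists d, n ∘ d = c ∘ e) -> exists c', n ∘ c' = c.
  move=> Se [d dE].
  have [|Q Qb] := @regular_pullback _ (sf_regular A) _ _ _ c n.
    by exists y1, e, d.
  have [k [[k1 k2] _]] := proj2 Qb _ e d (esym dE).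
  have [|k' /= k'E] := @surjective_sec _ _ _ _
      (Mono (pullback_monic Qb (@mmapP _ _ n))) Se; first by exists k.
  by exists (rgt Q ∘ k'); rewrite ccompA -(proj1 Qb) -ccompA k'E ccompf1.
split; (split; first by [exists a; rewrite /= ccomp1f|exists b; rewrite /= ccomp1f]).
  move=> n [h hE]; apply: key; first by exists h.
  by apply: (fact _ _ g) => //; exists (h ∘ f); rewrite ccompA hE.
move=> n [h hE]; apply: key; last by exists h.
by apply: (fact _ _ f) => //; exists (h ∘ g); rewrite ccompA hE.
Qed.

Variables (K : fieldType) (delta : degree_function A K).

(* For [u] given by [a : x ->> q <<- y : b], this is p_y^* [b]^v [a] p_x^*; the
   outer factors are supplied by [star_hom]. *)
Definition brace x y (u : Rq x y) : Thom (star delta x) (star delta y) :=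
  star_hom delta
    (comp0 delta (pull K (qrgt (repr u))) (push K (qlft (repr u)))).

End Quotients.

(* Main.v *)
(** The composite [{v}'{u}'] contains [[c] p_y^* [b]^v], where [b] and [c] are
   the maps from [y] to the vertices of [u] and [v].  Factoring [(b, c)] through
   its image [e : y ->> ybar] and using [[e] p_y^* [e]^v = omega_e p_ybar^*]
   turns it into [omega_e] times the sum over the subobjects [m] of [ybar] of
   [mu(m, ybar) <m>].  The terms with [m] not projecting onto both vertices are
   killed by [p_x^*] or [p_z^*]; by Carboni, Kelly and Pedicchio the other [m]
   form an up-closed set isomorphic to the interval of all [t <= w] in [R_q], and
   for them [<m> = [t_r]^v [t_l]]. *)

From HB Require Import structures.
From mathcomp Require Import all_boot all_order all_algebra.
From mathcomp Require Import boolp classical_sets functions cardinality fsbigop.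
(* [Defs] comes last because [all_algebra] also defines a constant [hom]. *)
Require Import Defs.

Set Implicit Arguments.
Unset Strict Implicit.
Unset Printing Implicit Defensive.

Import Order.TTheory GRing.Theory.
Local Open Scope ring_scope.

(** * Generalized elements, covers and descent in a regular category *)

Section RegularEpimorphisms.
Variable A : sf_regular_category.
Implicit Types x y z t : A.

Lemma is_pullback_sym x y z (f : hom x z) (g : hom y z) (s : span x y) :
  is_pullback f g s -> is_pullback g f (Span (rgt s) (lft s)).
Proof.
move=> [fg U]; split=> //= t a b ab; have [h [[h1 h2] hU]] := U t b a (esym ab).
by exists h; split=> // k [k1 k2]; apply: hU.
Qed.

(** This replaces choosing preimages of elements: a generalized element of [y] lifts to [x] after
    passing to a cover [c], namely the pullback of [e]. *)
Lemma surjective_lift x y t (e : hom x y) (f : hom t y) : surjective e ->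
  exists t' (c : hom t' t) (g : hom t' x), surjective c /\ e ∘ g = f ∘ c.
Proof.
move=> Se; have [[s Hs] /(_ _ Hs) Sr] := regular_surjective (sf_regular A) f Se.
by exists (apex s), (rgt s), (lft s); split=> //; exact: (proj1 Hs).
Qed.

(* The image of [(e, f)] in [y * z] is the graph of the wanted map. *)
Lemma surjective_factor x y z (e : hom x y) (f : hom x z) : surjective e ->
  (forall t (a b : hom t x), e ∘ a = e ∘ b -> f ∘ a = f ∘ b) ->
  exists g, g ∘ e = f.
Proof.
move=> Se ef; pose s := Span e f.
have [m1 m2] := span_im_mapP s; have Sm := span_im_map_surj s.
set m := span_im_map s in m1 m2 Sm *.
set r := relation_span _ in m m1 m2 Sm *.
have Sl : surjective (lft r).
  by apply: (@surjective_cancel _ _ _ _ (lft r) m); rewrite m1.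
have Ml : monic (lft r).
  move=> t a b ab; apply: relation_monic => //.
  (* Lift [a] and [b] through [m] over one common cover. There [ef] compares their second
     coordinates, and the equality descends because covers are epic. *)
  have [t1 [c [a' [Sc aE]]]] := surjective_lift a Sm.
  have [t2 [d [b' [Sd bE]]]] := surjective_lift (b ∘ c) Sm.
  apply: (surjective_epic (surjective_comp Sc Sd)).
  have aE' : m ∘ (a' ∘ d) = a ∘ (c ∘ d) by rewrite ccompA aE ccompA.
  have bE' : m ∘ b' = b ∘ (c ∘ d) by rewrite bE ccompA.
  rewrite -!ccompA -aE' -bE' !ccompA -/r m2 -ccompA; apply: ef.
  change e with (lft s); rewrite -m1 -!(ccompA (lft r)) aE' bE'.
  by rewrite (ccompA (lft r) a) (ccompA (lft r) b) ab.
have [k [kl lk]] := monic_surjective Ml Sl.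
exists (rgt r ∘ k); change e with (lft s).
rewrite -m1 -ccompA (ccompA k) kl ccomp1f.
exact: m2.
Qed.

Definition jointly_monic x y (s : span x y) :=
  forall t (a b : hom t (apex s)),
    lft s ∘ a = lft s ∘ b -> rgt s ∘ a = rgt s ∘ b -> a = b.

(** The counterpart of [related] for an arbitrary span, not only for the chosen representative of a
    relation. *)
Definition in_span x y (s : span x y) t (a : hom t x) (b : hom t y) :=
  exists h, lft s ∘ h = a /\ rgt s ∘ h = b.

(** Joint monicity forces [h] to identify whatever [c] identifies, so [h] descends along the cover
    [c]. *)
Lemma in_span_descent x y (s : span x y) t t' (a : hom t x) (b : hom t y)
    (c : hom t' t) : jointly_monic s -> surjective c ->
  in_span s (a ∘ c) (b ∘ c) -> in_span s a b.
Proof.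
move=> Ms Sc [h [h1 h2]]; have [|g gE] := surjective_factor (f := h) Sc.
  move=> t1 k l kl.
  by apply: Ms; rewrite !ccompA ?h1 ?h2 -!ccompA kl.
by exists g; split; apply: (surjective_epic Sc); rewrite -ccompA gE.
Qed.

(** Taking an image is existential quantification, which in a regular category is witnessed only
    after passing to a cover. *)
Lemma related_span_im x y (s : span x y) t (a : hom t x) (b : hom t y) :
  related (span_im s) a b <->
  exists t' (c : hom t' t), surjective c /\ in_span s (a ∘ c) (b ∘ c).
Proof.
have [m1 m2] := span_im_mapP s; have Sm := span_im_map_surj s.
split=> [[h [<- <-]]|[t' [c [Sc [h [h1 h2]]]]]].
  have [t' [c [g [Sc gE]]]] := surjective_lift h Sm.
  exists t', c; split=> //; exists g.
  by rewrite -m1 -m2 -!ccompA gE.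
apply: (in_span_descent (s := relation_span (span_im s)) _ Sc).
  exact: (@relation_monic _ _ _ (span_im s)).
by exists (span_im_map s ∘ h); rewrite !ccompA m1 m2.
Qed.

Lemma is_pullback_in_span x y z (f : hom x z) (g : hom y z) (s : span x y) t
    (a : hom t x) (b : hom t y) :
  is_pullback f g s -> f ∘ a = g ∘ b -> in_span s a b.
Proof. by move=> [_ U] /U[h [hE _]]; exists h. Qed.

Lemma is_pullback_jointly_monic x y z (f : hom x z) (g : hom y z) (s : span x y) :
  is_pullback f g s -> jointly_monic s.
Proof. by move=> Hs t a b; apply: (pullback_ext Hs). Qed.

Lemma is_pullbackI x y z (f : hom x z) (g : hom y z) (s : span x y) :
  jointly_monic s -> f ∘ lft s = g ∘ rgt s ->
  (forall t (a : hom t x) (b : hom t y), f ∘ a = g ∘ b -> in_span s a b) ->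
  is_pullback f g s.
Proof.
move=> Ms fg U; split=> // t a b /U[h [h1 h2]]; exists h; split=> // k [k1 k2].
by apply: Ms; rewrite ?h1 ?h2 ?k1 ?k2.
Qed.

(** The map [h] makes the relation defined by [t] smaller than the one defined by [t'], which is
    [s]; the equation on [s] gives the reverse inclusion. *)
Lemma is_pullback_qhom x y (t t' : qdiagram x y) (h : hom (qapex t) (qapex t'))
    (s : span x y) : qhom h -> qlft t ∘ lft s = qrgt t ∘ rgt s ->
  is_pullback (qlft t') (qrgt t') s -> is_pullback (qlft t) (qrgt t) s.
Proof.
move=> [h1 h2] ts Hs; apply: is_pullbackI => //.
  exact: is_pullback_jointly_monic Hs.
move=> k a b ab; apply: (is_pullback_in_span Hs).
by rewrite -h1 -h2 -!ccompA ab.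
Qed.

(** A pullback square of surjections is also a push-out; this is the existence half. If [a] and [b]
    agree in the vertex, then over a cover both are related by [s] to the same [d], and [f] sends
    both to [g ∘ d]. *)
Lemma is_pullback_pushout x y (t : qdiagram x y) (s : span x y) z
    (f : hom x z) (g : hom y z) :
  is_pullback (qlft t) (qrgt t) s -> f ∘ lft s = g ∘ rgt s ->
  exists h, h ∘ qlft t = f /\ h ∘ qrgt t = g.
Proof.
move=> Hs fg.
have eqz k (a : hom k x) (c : hom k y) :
    qlft t ∘ a = qrgt t ∘ c -> f ∘ a = g ∘ c.
  by move=> /(is_pullback_in_span Hs)[h [<- <-]]; rewrite !ccompA fg.
have [|h hE] := surjective_factor (f := f) (qlft_surj t).
  move=> k a b ab.
  have [k' [c [d [Sc dE]]]] := surjective_lift (qlft t ∘ a) (qrgt_surj t).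
  apply: (surjective_epic Sc); rewrite -!ccompA.
  by rewrite (eqz _ (a ∘ c) d) ?(eqz _ (b ∘ c) d) ?dE ?ab ?ccompA ?ab.
exists h; split=> //.
have [k [c [d [Sc dE]]]] := surjective_lift (qrgt t) (qlft_surj t).
apply: (surjective_epic Sc).
by rewrite -ccompA -dE ccompA hE; exact: eqz.
Qed.

(** Reduces the order on quotient diagrams to inclusion of the relations they define. *)
Lemma qhom_span_hom x y (t t' : qdiagram x y) (s s' : span x y) :
  is_pullback (qlft t) (qrgt t) s -> is_pullback (qlft t') (qrgt t') s' ->
  (exists h : hom (qapex t) (qapex t'), qhom h) <->
  (exists h : hom (apex s) (apex s'), span_hom h).
Proof.
move=> Hs Hs'; split=> [[h [h1 h2]]|[h [h1 h2]]].
  apply: (is_pullback_in_span Hs').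
  by rewrite -h1 -h2 -!ccompA (proj1 Hs).
apply: (is_pullback_pushout Hs).
by rewrite -h1 -h2 !ccompA (proj1 Hs').
Qed.

Lemma repr_Rq_of_qhom x y (t : qdiagram x y) :
  (exists h : hom (qapex t) (qapex (repr (Rq_of t))), qhom h) /\
  (exists h : hom (qapex (repr (Rq_of t))) (qapex t), qhom h).
Proof. by apply/Rq_ofP; rewrite /Rq_of reprK. Qed.

Lemma is_pullback_repr x y (t : qdiagram x y) (s : span x y) :
  is_pullback (qlft t) (qrgt t) s <->
  is_pullback (qlft (repr (Rq_of t))) (qrgt (repr (Rq_of t))) s.
Proof.
have [[h hq] [k kq]] := repr_Rq_of_qhom t.
split=> Hs.
  apply: (is_pullback_qhom kq) => //.
  by rewrite -(proj1 hq) -(proj2 hq) -!ccompA (proj1 Hs).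
apply: (is_pullback_qhom hq) => //.
by rewrite -(proj1 kq) -(proj2 kq) -!ccompA (proj1 Hs).
Qed.

End RegularEpimorphisms.

(** * Difunctionality and the Carboni-Kelly-Pedicchio theorem *)

Section ExactMaltsev.
Variable A : sf_regular_category.
Hypotheses (A_exact : is_exact A) (A_maltsev : is_maltsev A).
Implicit Types x y z t : A.

(* Apply the Mal'tsev property to the relation [(a, c) ~ (a', c') iff
   (a, c') in s] on the apex of [s]. *)
Lemma maltsev_difunctional x y (s : span x y) t (a b : hom t x) (c d : hom t y) :
  jointly_monic s -> in_span s a c -> in_span s b c -> in_span s b d ->
  in_span s a d.
Proof.
move=> Ms [i [iE1 iE2]] bc [j [jE1 jE2]].
have [P Pp] := product_exists (Span (idm (apex s)) (idm (apex s))).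
have [Q Qp] := product_exists s.
have [m [[m1 m2] _]] := Qp _ (lft s) (rgt s).
have [n [[n1 n2] _]] := Qp _ (lft s ∘ lft P) (rgt s ∘ rgt P).
(* With [Q] the product of [x] and [y], [m] includes [s] and [n] takes the first coordinate of one
   point of [s] and the second coordinate of another; [B] selects the pairs whose mixed point lies
   in [s] again. *)
have [|B HB] := @regular_pullback _ (sf_regular A) _ _ _ m n.
  have [k [[k1 k2] _]] := Pp _ (idm (apex s)) (idm (apex s)).
  exists (apex s), (idm _), k; apply: (prod_ext Qp).
    by rewrite !ccompA m1 n1 -ccompA k1.
  by rewrite !ccompA m2 n2 -ccompA k2.
have B1 : lft s ∘ lft B = lft s ∘ lft P ∘ rgt B.
  by rewrite -n1 -m1 -!ccompA (proj1 HB).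
have B2 : rgt s ∘ lft B = rgt s ∘ rgt P ∘ rgt B.
  by rewrite -n2 -m2 -!ccompA (proj1 HB).
pose E := Span (lft P ∘ rgt B) (rgt P ∘ rgt B).
have EP k (f g : hom k (apex s)) :
    in_span E f g <-> in_span s (lft s ∘ f) (rgt s ∘ g).
  split=> [[h [<- <-]]|[h [h1 h2]]].
    by exists (lft B ∘ h); rewrite /= !ccompA B1 B2.
  have [l [[l1 l2] _]] := Pp _ f g.
  have [|h' [h'1 h'2]] := is_pullback_in_span (a := h) (b := l) HB.
    apply: (prod_ext Qp); rewrite !ccompA ?m1 ?m2 ?n1 ?n2 -!ccompA ?l1 ?l2 //.
  by exists h'; rewrite /= -!ccompA h'2.
have ME : jointly_monic E.
  move=> k f g /= fg1 fg2; apply: (pullback_ext HB).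
    apply: Ms; rewrite !ccompA ?B1 ?B2 -?(ccompA (lft s)) -?(ccompA (rgt s)).
      by rewrite fg1.
    by rewrite fg2.
  by apply: (prod_ext Pp); rewrite !ccompA.
have relE k (f g : hom k (apex s)) :
    related (span_im E) f g <-> in_span s (lft s ∘ f) (rgt s ∘ g).
  rewrite related_span_im -EP; split=> [[k' [e [Se]]]|fg].
    exact: in_span_descent.
  by exists k, (idm k); rewrite !ccompf1; split=> //; exact: surjective_id.
have [|_ sym _] := @A_maltsev _ (span_im E) _ t.
  by apply/relE; exists (idm _).
(* Here [i] is the point [(a, c)] and [j] is [(b, d)]: the claim says that [i] is related to [j],
   the hypothesis on [(b, c)] that [j] is related to [i]. *)
rewrite -iE1 -jE2; apply/relE/sym/relE.
by rewrite jE1 iE2.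
Qed.

(* Carboni, Kelly and Pedicchio: the vertex is the quotient of [x] by the
   relation [s^-1 s]. *)
Theorem exact_maltsev_pullback x y (s : span x y) :
  jointly_monic s -> surjective (lft s) -> surjective (rgt s) ->
  exists t : qdiagram x y, is_pullback (qlft t) (qrgt t) s.
Proof.
move=> Ms Sl Sr.
have [[B HB] _] := regular_surjective (sf_regular A) (rgt s) Sr.
pose S := Span (lft s ∘ lft B) (lft s ∘ rgt B).
have SP k (f g : hom k x) :
    in_span S f g <-> exists c, in_span s f c /\ in_span s g c.
  split=> [[h [<- <-]]|[c [[h [<- h2]] [l [<- l2]]]]].
    exists (rgt s ∘ (lft B ∘ h)); split.
      by exists (lft B ∘ h); rewrite /= ccompA.
    by exists (rgt B ∘ h); rewrite /= !ccompA (proj1 HB).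
  have [|i [i1 i2]] := is_pullback_in_span (a := h) (b := l) HB.
    by rewrite h2 l2.
  by exists i; rewrite /= -!ccompA i1 i2.
have [|t [e [Se He]]] := @A_exact _ (span_im S).
  (* [S] relates elements of [x] that share a partner in [y]. Over the cover [lft s] every element
     has a partner, so the diagonal is contained in the image of [S]. *)
  apply: A_maltsev; apply/related_span_im; exists (apex s), (lft s); split=> //.
  by apply/SP; exists (rgt s); split; exists (idm _); rewrite !ccompf1 ccomp1f.
have eP k (f g : hom k x) :
    e ∘ f = e ∘ g <-> related (span_im S) f g.
  split=> [/(is_pullback_in_span He)//|[h [<- <-]]].
  by rewrite !ccompA (proj1 He).
have [|g gE] := surjective_factor (f := e ∘ lft s) Sr.
  move=> k f h fh; rewrite -!ccompA; apply/eP/related_span_im.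
  exists k, (idm k); split; first exact: surjective_id.
  rewrite !ccompf1; apply/SP; exists (rgt s ∘ f).
  by split; [exists f | exists h; rewrite fh].
have Sg : surjective g.
  apply: (@surjective_cancel _ _ _ _ g (rgt s)).
  by rewrite gE; exact: surjective_comp.
exists (QDiagram Se Sg); apply: is_pullbackI => //= k a c ac.
(* Over a cover, [c] has a partner [lft s ∘ h], which [e] identifies with [a]. Hence the two share
   some partner [d], and difunctionality relates [a] to [c]. *)
have [k' [f [h [Sf hE]]]] := surjective_lift c Sr.
have /eP/related_span_im[k'' [f' [Sf' /SP[d [ad hd]]]]] :
    e ∘ (a ∘ f) = e ∘ (lft s ∘ h).
  by rewrite !ccompA -gE ac -!ccompA hE.
apply: (in_span_descent Ms (surjective_comp Sf Sf')).
apply: (maltsev_difunctional (b := lft s ∘ h ∘ f') (c := d) Ms) hd _.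
  by rewrite ccompA.
by exists (h ∘ f'); rewrite !ccompA hE.
Qed.

End ExactMaltsev.

(** * Composition rules for [push], [pull] and the projectors *)

Section PushPull.
Variables (A : sf_regular_category) (K : fieldType).
Variable delta : degree_function A K.
Implicit Types x y z t : A.

Local Notation comp0 := (comp0 delta).
Local Notation span_vec := (span_vec delta).
Local Notation p_ := (p_ delta).
Local Notation pstar x := (pstar delta (sub_top x)).

Lemma is_pullback_idr x y (f : hom x y) :
  is_pullback f (idm y) (Span (idm x) f).
Proof.
apply: is_pullbackI => /= [t a b|//|t a b] /=.
- by rewrite !ccomp1f.
- by rewrite ccompf1 ccomp1f.
by rewrite ccomp1f => <-; exists a; rewrite ccomp1f.
Qed.

Lemma push_span x y z (g : hom y z) (s : span x y) :
  comp0 (push K g) (span_vec s) = span_vec (Span (lft s) (g ∘ rgt s)).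
Proof.
rewrite (pushE delta) (comp0_span delta (s := Span _ _) (is_pullback_idr (rgt s))).
by rewrite /span_comp /= ccompf1.
Qed.

Lemma span_pull x y z (f : hom y x) (s : span y z) :
  comp0 (span_vec s) (pull K f) = span_vec (Span (f ∘ lft s) (rgt s)).
Proof.
rewrite (pullE delta) (comp0_span delta (r := Span _ _)
  (is_pullback_sym (is_pullback_idr (lft s)))).
by rewrite /span_comp /= ccompf1.
Qed.

Lemma pull_push x y z (f : hom x z) (g : hom y z) (s : span x y) :
  is_pullback f g s -> comp0 (pull K g) (push K f) = span_vec s.
Proof.
move=> Hs; rewrite (pushE delta) (pullE delta).
rewrite (comp0_span delta (r := Span _ _) (s := Span _ _) Hs) /span_comp /=.
by rewrite !ccomp1f; case: (s).
Qed.

Lemma push_comp x y z (g : hom y z) (f : hom x y) :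
  comp0 (push K g) (push K f) = push K (g ∘ f).
Proof. by rewrite (pushE delta f) push_span -(pushE delta). Qed.

Lemma pull_comp x y z (g : hom y z) (f : hom x y) :
  comp0 (pull K f) (pull K g) = pull K (g ∘ f).
Proof. by rewrite (pullE delta f) span_pull /= -(pullE delta). Qed.

Lemma push_span_pull x x' y y' (f : hom x x') (g : hom y y') (s : span x y) :
  comp0 (push K g) (comp0 (span_vec s) (pull K f)) =
  span_vec (Span (f ∘ lft s) (g ∘ rgt s)).
Proof. by rewrite span_pull push_span. Qed.

(** Both sides are the span from [x] to [y] whose apex is the preimage of [v] under [e]. *)
Lemma p_push x y (e : hom x y) (v : sub y) (s : span x (mdom (subm v)))
    (Hs : is_pullback e (subm v) s) :
  comp0 (p_ v) (push K e) =
  comp0 (push K e) (p_ (sub_of (Mono (pullback_monic Hs (@mmapP _ _ (subm v)))))).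
Proof.
rewrite -(p_mono delta (erefl (sub_of (Mono _)))) push_span p_E (pushE delta).
rewrite (comp0_span delta (r := Span _ _) (s := Span _ _) Hs) /span_comp /=.
by rewrite ccomp1f (proj1 Hs).
Qed.

Lemma pull_p x y (e : hom x y) (v : sub y) (s : span x (mdom (subm v)))
    (Hs : is_pullback e (subm v) s) :
  comp0 (pull K e) (p_ v) =
  comp0 (p_ (sub_of (Mono (pullback_monic Hs (@mmapP _ _ (subm v)))))) (pull K e).
Proof.
rewrite -(p_mono delta (erefl (sub_of (Mono _)))) span_pull p_E (pullE delta).
rewrite (comp0_span delta (r := Span _ _) (s := Span _ _) (is_pullback_sym Hs)).
by rewrite /span_comp /= ccomp1f (proj1 Hs).
Qed.

(** Products of projectors are given by meets, which are symmetric. The mixed cases cannot occur,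
    because a meet is itself a common lower bound. *)
Lemma p_comm x (u v : sub x) : comp0 (p_ u) (p_ v) = comp0 (p_ v) (p_ u).
Proof.
case: (p_comp delta u v) (p_comp delta v u) => [[-> d]|[w m ->]].
  case=> [[-> _]//|[w' m' _]]; have := m' w'; rewrite lexx => /esym.
  by rewrite andbC (negPf (d w')).
case=> [[_ d]|[w' m' ->]].
  by have := m w; rewrite lexx andbC (negPf (d w)).
by congr p_; apply/eqP; rewrite eq_le m' [X in X && _]andbC -m lexx m /= andbC -m' lexx.
Qed.

Lemma pstar_p x (v : sub x) : v != sub_top x -> comp0 (pstar x) (p_ v) = 0.
Proof.
move=> vT; rewrite -[RHS](p_pstar delta vT) /Defs.pstar (comp0_suml delta).
rewrite (comp0_sumr delta); apply: eq_bigr => u _; congr (_ *: _).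
exact: p_comm.
Qed.

Lemma sub_of_eq_top x (m : mono x) : sub_of m = sub_top x <-> surjective m.
Proof.
split=> [/sub_ofP[_ [k /= kE]]|Sm].
  by apply: (@surjective_cancel _ _ _ _ m k); rewrite kE; exact: surjective_id.
apply/sub_ofP; split; first by exists m; rewrite /= ccomp1f.
by have [k kE] := surjective_sec Sm (factors_refl m); exists k.
Qed.

(** If the preimage were all of [x], the surjective [e ∘ lft s] would factor through [v]. *)
Lemma preimage_ne_top x y (e : hom x y) (v : sub y) (s : span x (mdom (subm v)))
    (Hs : is_pullback e (subm v) s) : surjective e -> v != sub_top y ->
  sub_of (Mono (pullback_monic Hs (@mmapP _ _ (subm v)))) != sub_top x.
Proof.
move=> Se; apply: contra_neq => /sub_of_eq_top /= Sl.
rewrite -(submK v); apply/sub_of_eq_top.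
apply: (@surjective_cancel _ _ _ _ (subm v) (rgt s)); rewrite -(proj1 Hs).
exact: surjective_comp.
Qed.

(** Moved past [push K e], the projector [p_ v] becomes that of the preimage, which is still proper
    and therefore killed by [pstar x]. *)
Lemma p_push_pstar x y (e : hom x y) (v : sub y) : surjective e ->
  v != sub_top y -> comp0 (p_ v) (comp0 (push K e) (pstar x)) = 0.
Proof.
move=> Se vT; have [[s Hs] _] := regular_surjective (sf_regular A) (subm v) Se.
by rewrite comp0A (p_push Hs) -comp0A p_pstar ?preimage_ne_top // comp00r.
Qed.

Lemma pstar_pull_p x y (e : hom x y) (v : sub y) : surjective e ->
  v != sub_top y -> comp0 (comp0 (pstar x) (pull K e)) (p_ v) = 0.
Proof.
move=> Se vT; have [[s Hs] _] := regular_surjective (sf_regular A) (subm v) Se.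
by rewrite -comp0A (pull_p Hs) comp0A pstar_p ?preimage_ne_top // comp00l.
Qed.

Lemma im_top x y (f : hom x y) : im f = sub_top y <-> surjective f.
Proof.
split=> [fT|Sf].
  have [h _] := sub_ofK (mono_id y).
  have [_ h2] := imP f; rewrite fT in h2.
  split=> [|n /h2]; first by exists f; rewrite /= ccomp1f.
  exact: factors_trans h.
by apply: im_unique; apply: is_image_trans Sf _ _; case: (sub_ofK (mono_id y)).
Qed.

Lemma span_vec_graph x y (f : hom x y) :
  exists k, span_vec (Span f f) = k *: p_ (im f).
Proof.
have [[h hE] _] := imP f; have Sh := im_mono_surj x (imP f) hE.
exists (degree delta h); rewrite p_E.
exact: (span_vec_surj delta (s := Span f f) (s' := Span _ _) Sh).
Qed.

Lemma span_vec_surj_graph x y (f : hom x y) : surjective f ->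
  span_vec (Span f f) = degree delta f *: p_ (sub_top y).
Proof.
move=> Sf; rewrite -(p_mono delta (erefl (sub_of (mono_id y)))).
apply: (span_vec_surj delta (s := Span f f) (s' := Span _ _) Sf).
by split; rewrite /= ccomp1f.
Qed.

Lemma push_pstar_pull x y (f : hom x y) :
  comp0 (push K f) (comp0 (pstar x) (pull K f)) =
  \sum_(u : sub x) (mobius u (sub_top x))%:~R *:
    span_vec (Span (f ∘ subm u) (f ∘ subm u)).
Proof.
rewrite /Defs.pstar (comp0_suml delta) (comp0_sumr delta).
apply: eq_big => [u|u _]; first by rewrite sub_le_top.
by rewrite p_E push_span_pull.
Qed.

(** Only the term of the top subobject survives in [pstar x]; it is the identity with coefficient
    1. *)
Lemma pstar_id_on x z (f : {ffun relation z x -> K^o}) :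
  (forall v, v != sub_top x -> comp0 (p_ v) f = 0) -> comp0 (pstar x) f = f.
Proof.
move=> f0; rewrite /Defs.pstar (comp0_suml delta) (bigD1 (sub_top x)) //=.
rewrite big1 ?addr0 => [|u /andP[_ uT]]; last by rewrite f0 // scaler0.
by rewrite p_top (comp01f delta) mobiusE ?eqxx ?scale1r //; exact: sub_finite.
Qed.

(* The left-hand side is killed by [p_ v] for every proper [v], so it equals
   its product with [pstar y], which kills all its terms [p_ v] but [v = y]. *)
Lemma push_pstar_pull_omega x y (e : hom x y) : surjective e ->
  comp0 (push K e) (comp0 (pstar x) (pull K e)) = omega delta e *: pstar y.
Proof.
move=> Se; rewrite -[LHS]pstar_id_on => [|v vT]; last first.
  by rewrite !(comp0A delta) -(comp0A delta (p_ v)) p_push_pstar // comp00l.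
rewrite push_pstar_pull (comp0_sumr delta) /omega scaler_suml.
rewrite [RHS]big_mkcond; apply: eq_bigr => u _ /=.
case: eqP => [/im_top Sf|fT].
  by rewrite span_vec_surj_graph // comp0Zr scalerA p_top comp0f1.
have [k ->] := span_vec_graph (e ∘ subm u).
by rewrite comp0Zr pstar_p ?scaler0 //; apply/eqP.
Qed.

End PushPull.

(** On the up-closed [G] the map [phi] identifies the interval from [a] to [b] with that from
    [phi a] to [phi b], and the Moebius function depends on this interval only. Outside [G], [phi]
    may be arbitrary. *)
Lemma mobius_transport d d' (T : porderType d) (T' : porderType d')
    (phi : T -> T') (G : set T) (b : T) :
  (forall a, finite_set [set c : T | (a <= c <= b)%O]) ->
  (forall a c, G a -> (a <= c)%O -> G c) ->
  (forall a c, G a -> G c -> (phi a <= phi c)%O = (a <= c)%O) ->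
  (forall t, (t <= phi b)%O -> exists2 c, G c & phi c = t) ->
  forall a, G a -> (a <= b)%O -> mobius (phi a) (phi b) = mobius a b.
Proof.
move=> fin up le_phi sur a.
have [n] := ubnP (interval_size a b); elim: n a => // n IH a.
rewrite ltnS => sz Ga ab; have Gb := up _ _ Ga ab.
have lt_phi c : G c -> (phi a < phi c)%O = (a < c)%O.
  by move=> Gc; rewrite !lt_leAnge !le_phi.
have bij : set_bij [set c : T | (a < c <= b)%O]
    [set t : T' | (phi a < t <= phi b)%O] phi.
  split=> [c /= /andP[ac cb]|c c'|t /= /andP[lat tb]].
  - by have Gc := up _ _ Ga (ltW ac); rewrite lt_phi // le_phi // ac.
  - rewrite !inE /= => /andP[ac _] /andP[ac' _] E.
    have Gc := up _ _ Ga (ltW ac); have Gc' := up _ _ Ga (ltW ac').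
    by apply/eqP; rewrite eq_le -!le_phi // E lexx.
  have [c Gc cE] := sur _ tb; exists c => //=.
  by rewrite -lt_phi // -le_phi // cE lat.
have fin' : finite_set [set t : T' | (phi a <= t <= phi b)%O].
  apply: sub_finite_set (finite_image phi (fin a)) => t /= /andP[lat tb].
  have [c Gc cE] := sur _ tb; exists c => //=.
  by rewrite -!le_phi // cE lat.
rewrite !mobiusE // lt_phi //.
rewrite [phi a == _]eq_le !le_phi // -eq_le; case: eqP => // _; case: ifP => // _.
congr (- _); rewrite (reindex_fsbig _ _ _ _ bij).
apply: eq_fsbigr => c; rewrite inE /= => /andP[ac cb].
apply: IH => //; last exact: up (ltW ac).
by have [_ lt] := interval_size_lt (fin a) ac cb; exact: leq_trans sz.
Qed.

Definition restrict (A : sf_regular_category) (x y : A) (s : span x y)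
    (m : sub (apex s)) : span x y :=
  Span (lft s ∘ subm m) (rgt s ∘ subm m).
Arguments restrict {A x y} s m.

(** * Composition of morphisms between the objects [[x]^*] *)

Section StarHom.
Variables (A : sf_regular_category) (K : fieldType).
Variable delta : degree_function A K.
Implicit Types x y z t : A.

Local Notation comp0 := (comp0 delta).
Local Notation span_vec := (span_vec delta).
Local Notation p_ := (p_ delta).
Local Notation pstar x := (pstar delta (sub_top x)).

Lemma star_hom_linear x y : linear (@star_hom A K delta x y).
Proof.
have mat1P a (f g : {ffun relation x y -> K^o}) :
    mat1 (a *: f + g) = a *: mat1 f + mat1 g.
  by apply/ffunP => r; rewrite !ffunE.
move=> a f g; apply: val_inj; rewrite [RHS](linearP (vsval (U := Thom_space _ _))).
by rewrite /= mat1P; exact: (@sandwich_linear _ _ delta (star delta x) (star delta y)).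
Qed.

HB.instance Definition _ x y := GRing.isLinear.Build K _ _ _
  (@star_hom A K delta x y) (@star_hom_linear x y).

(** The two copies of [pstar y] that meet in the middle merge by idempotence; the outer factors are
    absorbed into [star_hom]. *)
Lemma Tcomp_star_hom x y z (g : {ffun relation y z -> K^o})
    (f : {ffun relation x y -> K^o}) :
  Tcomp (star_hom delta g) (star_hom delta f) =
  star_hom delta (comp0 g (comp0 (pstar y) f)).
Proof.
apply: val_inj; apply: etrans (esym (star_homE _ _)).
rewrite /= /sandwich /= !mat1_comp; congr mat1.
by rewrite !(comp0A delta) -(comp0A delta _ (pstar y) (pstar y)) pstar_idem.
Qed.

(** By [pull_push] the composite depends only on a pullback span, and [t] shares one with the
    representative of its class. *)
Lemma brace_Rq_of x y (t : qdiagram x y) :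
  brace delta (Rq_of t) =
  star_hom delta (comp0 (pull K (qrgt t)) (push K (qlft t))).
Proof.
have [[s Hs] _] :=
  regular_surjective (sf_regular A) (qrgt t) (qlft_surj t).
by rewrite /brace (pull_push delta Hs) (pull_push delta ((is_pullback_repr _ _).1 Hs)).
Qed.

Lemma push_pstar_pull_span x y (s : span x y) :
  comp0 (push K (rgt s)) (comp0 (pstar (apex s)) (pull K (lft s))) =
  omega delta (span_im_map s) *:
    \sum_(m : sub (apex (relation_span (span_im s))))
      (mobius m (sub_top _))%:~R *: span_vec (restrict (relation_span (span_im s)) m).
Proof.
have [e1 e2] := span_im_mapP s; have Se := span_im_map_surj s.
(* Factoring both legs through [e] isolates the product evaluated by [push_pstar_pull_omega];
   expanding [pstar] of the image then gives the sum. *)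
rewrite -[in LHS]e1 -[in LHS]e2; set e := span_im_map s in Se *.
rewrite -(push_comp delta) -(pull_comp delta).
rewrite [comp0 (pstar _) _](comp0A delta) (comp0A delta _ _ (pull K _)).
rewrite -(comp0A delta (push K _)) push_pstar_pull_omega //.
rewrite comp0Zr comp0Zl; congr (_ *: _).
rewrite /Defs.pstar (comp0_sumr delta) (comp0_suml delta).
apply: eq_big => [m|m _]; first by rewrite sub_le_top.
by rewrite p_E push_span span_pull.
Qed.

(** Exposes the projector of a possibly proper image. Nothing is lost, since the preimage of that
    image under [lft s] is the whole apex. *)
Lemma span_vec_lft_im x y (s : span x y) :
  span_vec s = comp0 (span_vec s) (p_ (im (lft s))).
Proof.
have [[h hE] _] := imP (lft s); rewrite p_E.
have Hs : is_pullback (subm (im (lft s))) (lft s) (Span h (idm _)).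
  apply: is_pullbackI => /= [t a b _|//|t a b ab].
  - by rewrite !ccomp1f.
  - by rewrite hE ccompf1.
  exists b; rewrite ccomp1f; split=> //.
  by apply: (@mmapP _ _ (subm (im (lft s)))); rewrite ccompA hE.
rewrite (comp0_span delta (r := Span _ _) Hs) /span_comp /= hE ccompf1.
by case: (s).
Qed.

Lemma span_vec_rgt_im x y (s : span x y) :
  span_vec s = comp0 (p_ (im (rgt s))) (span_vec s).
Proof.
have [[h hE] _] := imP (rgt s); rewrite p_E.
have Hs : is_pullback (rgt s) (subm (im (rgt s))) (Span (idm _) h).
  apply: is_pullbackI => /= [t a b|//|t a b ab] /=.
  - by rewrite !ccomp1f.
  - by rewrite hE ccompf1.
  exists a; rewrite ccomp1f; split=> //.
  by apply: (@mmapP _ _ (subm (im (rgt s)))); rewrite ccompA hE.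
rewrite (comp0_span delta (s := Span _ _) Hs) /span_comp /= hE ccompf1.
by case: (s).
Qed.

(** A leg with proper image splits off a projector [p_ v] with [v] proper; next to [push K a] and
    [pstar x], or to [pull K d] and [pstar y], it gives zero. *)
Lemma star_hom_nonsurjective x y x' y' (a : hom x x') (d : hom y y')
    (s : span x' y') : surjective a -> surjective d ->
  ~ (surjective (lft s) /\ surjective (rgt s)) ->
  star_hom delta (comp0 (pull K d) (comp0 (span_vec s) (push K a))) = 0.
Proof.
move=> Sa Sd ns; apply: val_inj; apply: etrans (star_homE _ _) _.
suff -> : comp0 (pstar y) (comp0 (comp0 (pull K d)
    (comp0 (span_vec s) (push K a))) (pstar x)) = 0.
  by apply/ffunP => r; rewrite !ffunE.
case: (pselect (surjective (lft s))) => [Sl|/im_top/eqP lT].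
  have rT : im (rgt s) != sub_top y' by apply/eqP => /im_top Sr; apply: ns.
  have := pstar_pull_p delta Sd rT; rewrite span_vec_rgt_im.
  by move: (p_ _) => p p0; rewrite !(comp0A delta) p0 !comp00l.
have := p_push_pstar delta Sa lT; rewrite span_vec_lft_im.
by move: (p_ _) => p p0; rewrite -!(comp0A delta) p0 !comp00r.
Qed.

End StarHom.

(** * Bisurjective subobjects of a pullback and the quotients below [w] *)

Section QuotientOfSubobject.
Variable A : sf_regular_category.
Hypotheses (A_exact : is_exact A) (A_maltsev : is_maltsev A).
Variables (x y : A) (w : qdiagram x y) (s : span x y).
Hypothesis w_pullback : is_pullback (qlft w) (qrgt w) s.

Definition bisurjective (m : sub (apex s)) :=
  `[< surjective (lft (restrict s m)) /\ surjective (rgt (restrict s m)) >].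

(* The value [Rq_of w] is junk: it is taken only off [bisurjective]. *)
Definition quotient_of (m : sub (apex s)) : Rq x y :=
  if pselect (exists t : qdiagram x y,
      is_pullback (qlft t) (qrgt t) (restrict s m)) is left h
  then Rq_of (sval (cid h)) else Rq_of w.

Let s_jointly_monic : jointly_monic s := is_pullback_jointly_monic w_pullback.

Lemma restrict_jointly_monic m : jointly_monic (restrict s m).
Proof.
move=> t a b; rewrite /= -!ccompA => h1 h2.
by apply: (@mmapP _ _ (subm m)); exact: s_jointly_monic.
Qed.

Lemma quotient_ofP m : bisurjective m ->
  is_pullback (qlft (repr (quotient_of m))) (qrgt (repr (quotient_of m)))
    (restrict s m).
Proof.
move=> /asboolP[Sl Sr]; rewrite /quotient_of; case: pselect => [h|[]]; last first.
  exact: exact_maltsev_pullback (@restrict_jointly_monic m) Sl Sr.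
by case: cid => t /= /is_pullback_repr.
Qed.

Lemma restrict_leP m m' : (m <= m')%O <->
  exists h : hom (apex (restrict s m)) (apex (restrict s m')), span_hom h.
Proof.
split=> [/sub_leP[h hE]|[h [h1 h2]]]; last apply/sub_leP; exists h.
  by split; rewrite /= -ccompA hE.
by apply: s_jointly_monic; rewrite ccompA ?h1 ?h2.
Qed.

Lemma Rq_leP (t t' : Rq x y) (k k' : span x y) :
  is_pullback (qlft (repr t)) (qrgt (repr t)) k ->
  is_pullback (qlft (repr t')) (qrgt (repr t')) k' ->
  (t <= t')%O <-> exists h : hom (apex k) (apex k'), span_hom h.
Proof.
move=> Hk Hk'; rewrite -(qhom_span_hom Hk Hk').
by split=> [/asboolP|h] //; apply/asboolP.
Qed.

Lemma quotient_of_le m m' : bisurjective m -> bisurjective m' ->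
  (quotient_of m <= quotient_of m')%O = (m <= m')%O.
Proof.
move=> Bm Bm'; have E := Rq_leP (quotient_ofP Bm) (quotient_ofP Bm').
by apply/idP/idP => [/E/restrict_leP|/restrict_leP/E].
Qed.

Lemma quotient_of_le_w m : bisurjective m -> (quotient_of m <= Rq_of w)%O.
Proof.
move=> Bm; apply/(Rq_leP (quotient_ofP Bm) ((is_pullback_repr _ _).1 w_pullback)).
by exists (subm m).
Qed.

(** The pullback [k] of [t] has surjective legs, being pulled back from surjections, and embeds into
    [s] because [t] lies below [w]; [m] is the class of this embedding. *)
Lemma quotient_of_surj (t : Rq x y) : (t <= Rq_of w)%O ->
  exists2 m, bisurjective m & quotient_of m = t.
Proof.
have [[k Hk] Sr] :=
  regular_surjective (sf_regular A) (qrgt (repr t)) (qlft_surj (repr t)).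
have {}Sr := Sr _ Hk.
have Sl : surjective (lft k).
  exact: (proj2 (regular_surjective (sf_regular A) (qlft (repr t))
    (qrgt_surj (repr t))) _ (is_pullback_sym Hk)).
move=> /(Rq_leP Hk ((is_pullback_repr _ _).1 w_pullback))[h [h1 h2]].
have Mh : monic h.
  move=> c a b ab; apply: (is_pullback_jointly_monic Hk);
  by rewrite -?h1 -?h2 -!ccompA ab.
have [[i /= iE] [j /= jE]] := sub_ofK (Mono Mh).
set m := sub_of _ in i iE j jE.
have i1 : lft (restrict s m) ∘ i = lft k by rewrite /= -ccompA iE.
have i2 : rgt (restrict s m) ∘ i = rgt k by rewrite /= -ccompA iE.
have j1 : lft k ∘ j = lft (restrict s m) by rewrite -h1 -ccompA jE.
have j2 : rgt k ∘ j = rgt (restrict s m) by rewrite -h2 -ccompA jE.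
have Bm : bisurjective m.
  apply/asboolP; split.
    by apply: (@surjective_cancel _ _ _ _ _ i); rewrite i1.
  by apply: (@surjective_cancel _ _ _ _ _ i); rewrite i2.
exists m => //; apply/eqP; rewrite eq_le; apply/andP; split.
  by apply/(Rq_leP (quotient_ofP Bm) Hk); exists j.
by apply/(Rq_leP Hk (quotient_ofP Bm)); exists i.
Qed.

Lemma bisurjective_up m m' : bisurjective m -> (m <= m')%O -> bisurjective m'.
Proof.
move=> /asboolP[Sl Sr] /restrict_leP[h [h1 h2]]; apply/asboolP; split.
  by apply: (@surjective_cancel _ _ _ _ _ h); rewrite h1.
by apply: (@surjective_cancel _ _ _ _ _ h); rewrite h2.
Qed.

(** Some [m] is sent to [w]. The top lies above it, so its value is at least [w], while every value
    is at most [w]. *)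
Lemma quotient_of_top : quotient_of (sub_top (apex s)) = Rq_of w.
Proof.
have [m Bm mw] := quotient_of_surj (lexx (Rq_of w)).
have Bt := bisurjective_up Bm (sub_le_top m).
apply/eqP; rewrite eq_le quotient_of_le_w //= -mw quotient_of_le //.
exact: sub_le_top.
Qed.

Lemma mobius_quotient_of m : bisurjective m ->
  mobius (quotient_of m) (Rq_of w) = mobius m (sub_top (apex s)).
Proof.
move=> Bm; rewrite -quotient_of_top.
apply: (mobius_transport (G := [set m | bisurjective m]%classic)) => //.
- by move=> a; exact: sub_finite.
- exact: bisurjective_up.
- exact: quotient_of_le.
- by rewrite quotient_of_top; exact: quotient_of_surj.
exact: sub_le_top.
Qed.

Lemma fsbig_quotient_of (V : nmodType) (F : Rq x y -> V) :
  \sum_(t \in [set t : Rq x y | (t <= Rq_of w)%O]%classic) F t =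
  \sum_(m : sub (apex s) | bisurjective m) F (quotient_of m).
Proof.
rewrite [RHS]bigfs ?index_enum_uniq // => [|m _]; last by rewrite mem_index_enum.
apply: reindex_fsbig; split=> [m /= Bm|m m'|t /= tw].
- exact: quotient_of_le_w.
- rewrite !inE /= => Bm Bm' E.
  by apply/eqP; rewrite eq_le -!quotient_of_le // E lexx.
by have [m Bm <-] := quotient_of_surj tw; exists m.
Qed.

End QuotientOfSubobject.

Theorem lemma6p3 (A : sf_regular_category)
    (A_exact : is_exact A) (A_maltsev : is_maltsev A)
    (K : fieldType) (delta : degree_function A K)
    (x y z : A) (u : qdiagram x y) (v : qdiagram y z)
    (w : qdiagram (qapex u) (qapex v))
    (w_pushout : is_pushout (qrgt u) (qlft v) w) :
  let s := Span (qrgt u) (qlft v) in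
  is_pullback (qlft w) (qrgt w) (relation_span (span_im s)) /\
  Tcomp (brace delta (Rq_of v)) (brace delta (Rq_of u)) =
  omega delta (span_im_map s) *:
    \sum_(t \in [set t : Rq (qapex u) (qapex v) | (t <= Rq_of w)%O]%classic)
      (mobius t (Rq_of w))%:~R *: brace delta (Rq_comp t).
Proof.
move=> s; set r := relation_span (span_im s); pose e := span_im_map s.
have [e1 e2] : span_hom e := span_im_mapP s.
have Se : surjective e := span_im_map_surj s.
have Mr : jointly_monic r := @relation_monic _ _ _ (span_im s).
have Sl : surjective (lft r).
  by apply: (@surjective_cancel _ _ _ _ _ e); rewrite e1; exact: qrgt_surj.
have Sr : surjective (rgt r).
  by apply: (@surjective_cancel _ _ _ _ _ e); rewrite e2; exact: qlft_surj.
have w_pullback : is_pullback (qlft w) (qrgt w) r.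
  (* The relation [r] is the pullback of some [t]. The push-out property maps [w] to [t], and
     [is_pullback_qhom] transfers the pullback to [w]. *)
  have [t Ht] := exact_maltsev_pullback A_exact A_maltsev Mr Sl Sr.
  have [|h [hq _]] := proj2 w_pushout _ (qlft t) (qrgt t).
    by rewrite -[qrgt u]e1 -[qlft v]e2 !ccompA (proj1 Ht).
  apply: is_pullback_qhom hq _ Ht; apply: (surjective_epic Se).
  by rewrite -!ccompA e1 e2; exact: (proj1 w_pushout).
split=> //.
rewrite !brace_Rq_of Tcomp_star_hom.
(* Reassociate so that the part from [qapex u] through [y] to [qapex v] stands alone in the
   middle. *)
rewrite (comp0A delta (pstar _ _)) -(comp0A delta (pull K (qrgt v))).
rewrite (comp0A delta (push K (qlft v))).
rewrite (push_pstar_pull_span delta s).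
rewrite comp0Zl comp0Zr linearZ /=; congr (_ *: _).
rewrite (comp0_suml delta) (comp0_sumr delta) linear_sum /=.
(* Reindex by bisurjective [m] and extend the sum by zero to all subobjects, so that the two sides
   can be compared term by term. *)
rewrite (fsbig_quotient_of A_exact A_maltsev w_pullback) [RHS]big_mkcond.
apply: eq_bigr => m _; rewrite linearZ /=.
case: ifPn => [Bm|/asboolP nB]; last first.
  rewrite star_hom_nonsurjective ?scaler0 //; first exact: qlft_surj.
  exact: qrgt_surj.
rewrite mobius_quotient_of //; congr (_ *: _).
(* The restricted relation is the pullback of its quotient [t], so its span vector equals [pull]
   after [push] along the legs of [t]. *)
have Hm := quotient_ofP A_exact A_maltsev w_pullback Bm.
rewrite /Rq_comp brace_Rq_of /= -(pull_push delta Hm).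
by rewrite -(push_comp delta) -(pull_comp delta) !(comp0A delta).
Qed.
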